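(* Let $G$ be a stratified group of step 2 equipped with a homogeneous distance $d$ such that the projection norm $\|\cdot\|_d$ of $d$ is strictly convex. Then every infinite geodesic $\gamma\colon\mathbb{R}\to(G,d)$ is affine.
   Context: A stratified group is a connected, simply connected Lie group $G$ whose (finite-dimensional real) Lie algebra has a decomposition $\mathfrak{g}=V_1\oplus V_2\oplus\dots\oplus V_s$ with $V_s\neq\{0\}$ and $[V_1,V_k]=V_{k+1}$ for all $k=1,\dots,s$, where $V_{s+1}=\{0\}$; $s$ is its step. The dilation by $\lambda\in\mathbb{R}$ is $\delta_\lambda\colon G\to G$, $\delta_\lambda\exp(X_1+X_2+\dots+X_s)=\exp(\lambda X_1+\lambda^2X_2+\dots+\lambda^sX_s)$ for $X_k\in V_k$. A homogeneous distance on $G$ is a left-invariant distance $d$ (a metric) with $d(\delta_\lambda(g),\delta_\lambda(h))=\lambda d(g,h)$ for all $\lambda>0$ and $g,h\in G$. The projection norm of $d$ is $\|\cdot\|_d\colon V_1\to\mathbb{R}$, $\|X\|_d=d(e,\exp(X))$, where $e$ is the identity element (it is a norm). An infinite geodesic in $(G,d)$ is an isometric (i.e. distance-preserving) embedding $\gamma\colon\mathbb{R}\to(G,d)$: $d(\gamma(t),\gamma(s))=|t-s|$ for all $t,s$. A curve in $G$ is affine if it is a left translation of a one-parameter subgroup, $\gamma(t)=g\exp(tX)$ for some $g\in G$, $X\in\mathfrak{g}$. A norm is strictly convex if its unit sphere contains no non-degenerate line segment. *)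

(* Defs.v *)
From HB Require Import structures.
From mathcomp Require Import all_boot all_order all_algebra.
From mathcomp Require Import all_classical all_reals all_analysis.
Set Implicit Arguments.
Unset Strict Implicit.
Unset Printing Implicit Defensive.
Import Order.TTheory GRing.Theory Num.Theory.
Import numFieldNormedType.Exports.
Local Open Scope classical_set_scope.
Local Open Scope ring_scope.

(* A group carrying a topology; compatibility of the two structures is part of
   [lie_group] below. *)
#[short(type="topGroupType")]
HB.structure Definition TopGroup := {G of Group G & Topological G}.

(* [Ck k U f] : f is of class C^k on the open set U.  In finite dimension the
   differential is C^k iff all directional derivatives are. *)
Fixpoint Ck (R : realType) (E F : normedModType R) (k : nat) (U : set E)
    (f : E -> F) : Prop :=
  match k with
  | 0%N => forall x, U x -> {for x, continuous f}
  | k'.+1 => (forall x, U x -> differentiable f x) /\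
             (forall v : E, Ck k' U (fun x => 'D_v f x))
  end.

Definition smooth_on (R : realType) (E F : normedModType R) (U : set E)
    (f : E -> F) : Prop := forall k, Ck k U f.

(* [par] is the inverse of [crd] on [cod]; the values of [crd] off [dom] and of
   [par] off [cod] are irrelevant. *)
Record chart (R : realType) (n : nat) (G : Type) := Chart {
  dom : set G;
  crd : G -> 'rV[R]_n;
  par : 'rV[R]_n -> G }.

Definition cod (R : realType) (n : nat) (G : Type) (c : chart R n G) :
  set 'rV[R]_n := crd c @` dom c.

Definition is_chart (R : realType) (n : nat) (G : topologicalType)
    (c : chart R n G) : Prop :=
  [/\ open (dom c), open (cod c),
      forall g, dom c g -> par c (crd c g) = g,
      forall g, dom c g -> {for g, continuous (crd c)} &
      forall x, cod c x -> {for x, continuous (par c)}].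

Definition smooth_atlas (R : realType) (n : nat) (G : topologicalType)
    (A : set (chart R n G)) : Prop :=
  [/\ forall c, A c -> is_chart c,
      forall g, exists2 c, A c & dom c g &
      forall a b, A a -> A b ->
        smooth_on [set x | cod a x /\ dom b (par a x)]
                  (fun x => crd b (par a x))].

Definition smooth_manifold (R : realType) (n : nat) (G : topologicalType)
    (A : set (chart R n G)) : Prop :=
  [/\ hausdorff_space G, @second_countable G & smooth_atlas A].

Definition lie_group (R : realType) (n : nat) (G : topGroupType)
    (A : set (chart R n G)) : Prop :=
  [/\ smooth_manifold A,
      continuous (fun p : G * G => (p.1 * p.2)%g),
      continuous (fun g : G => (g^-1)%g),
      forall a b c, A a -> A b -> A c ->
        smooth_on [set p : 'rV[R]_n * 'rV[R]_n |
                    [/\ cod a p.1, cod b p.2 &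
                        dom c (par a p.1 * par b p.2)%g]]
                  (fun p => crd c (par a p.1 * par b p.2)%g) &
      forall a b, A a -> A b ->
        smooth_on [set x | cod a x /\ dom b ((par a x)^-1)%g]
                  (fun x => crd b ((par a x)^-1)%g)].

Definition simply_connected (R : realType) (G : topologicalType) : Prop :=
  forall f : R -> G, {within `[0, 1], continuous f} -> f 0 = f 1 ->
  exists H : R * R -> G,
    [/\ {within `[0, 1] `*` `[0, 1], continuous H},
        forall t : R, 0 <= t <= 1 -> H (t, 0) = f t,
        forall t : R, 0 <= t <= 1 -> H (t, 1) = f 0 &
        forall s : R, 0 <= s <= 1 -> H (0, s) = f 0 /\ H (1, s) = f 0].

(* The Lie algebra is the tangent space at the identity, identified with R^n
   through the coordinates of a chart c around the identity.  [Ad c g] is the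
   differential at 1 of the conjugation by g, and the bracket is given by the
   differential ad of Ad at 1, i.e. [X, Y] = ad(X)(Y). *)
Definition Ad (R : realType) (n : nat) (G : topGroupType) (c : chart R n G)
    (g : G) (X : 'rV[R]_n) : 'rV[R]_n :=
  'D_X (fun x : 'rV[R]_n => crd c (g * par c x * g^-1)%g) (crd c 1%g).

Definition lie_bracket (R : realType) (n : nat) (G : topGroupType)
    (c : chart R n G) (X Y : 'rV[R]_n) : 'rV[R]_n :=
  'D_X (fun x : 'rV[R]_n => Ad c (par c x) Y) (crd c 1%g).

Definition one_parameter_subgroup (R : realType) (G : topGroupType)
    (f : R -> G) : Prop :=
  continuous f /\ forall s t, f (s + t) = (f s * f t)%g.

(* This determines exp: a one-parameter subgroup is determined by its initial
   velocity. *)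
Definition is_exp (R : realType) (n : nat) (G : topGroupType)
    (c : chart R n G) (exp : 'rV[R]_n -> G) : Prop :=
  forall X : 'rV[R]_n,
    one_parameter_subgroup (fun t : R => exp (t *: X)) /\
    is_derive (0 : R) (1 : R) (fun t : R => crd c (exp (t *: X))) X.

(* W is the linear span of all the brackets [X, Y] with X in U and Y in V. *)
Definition is_bracket_span (R : realType) (n : nat)
    (br : 'rV[R]_n -> 'rV[R]_n -> 'rV[R]_n) (U V W : {vspace 'rV[R]_n}) : Prop :=
  (forall X Y, X \in U -> Y \in V -> br X Y \in W) /\
  (forall W' : {vspace 'rV[R]_n},
     (forall X Y, X \in U -> Y \in V -> br X Y \in W') -> (W <= W')%VS).

(* The layers are V 1, ..., V s; the value V 0 is irrelevant. *)
Definition stratification (R : realType) (n : nat)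
    (br : 'rV[R]_n -> 'rV[R]_n -> 'rV[R]_n) (s : nat)
    (V : nat -> {vspace 'rV[R]_n}) : Prop :=
  [/\ (\sum_(k < s) V k.+1)%VS = fullv,
      directv (\sum_(k < s) V k.+1),
      V s != 0%VS,
      V s.+1 = 0%VS &
      forall k, (1 <= k <= s)%N -> is_bracket_span br (V 1%N) (V k) (V k.+1)].

Definition stratified_group (R : realType) (n : nat) (G : topGroupType)
    (A : set (chart R n G)) (c : chart R n G) (s : nat)
    (V : nat -> {vspace 'rV[R]_n}) : Prop :=
  [/\ lie_group A, connected [set: G], simply_connected R G,
      A c /\ dom c 1%g & stratification (lie_bracket c) s V].

Definition is_dilation (R : realType) (n : nat) (G : topGroupType)
    (exp : 'rV[R]_n -> G) (s : nat) (V : nat -> {vspace 'rV[R]_n})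
    (delta : R -> G -> G) : Prop :=
  forall (l : R) (X : 'I_s -> 'rV[R]_n), (forall k, X k \in V k.+1) ->
    delta l (exp (\sum_(k < s) X k)) = exp (\sum_(k < s) l ^+ k.+1 *: X k).

Definition is_metric (R : realType) (T : Type) (d : T -> T -> R) : Prop :=
  [/\ forall x y, 0 <= d x y,
      forall x y, d x y = 0 <-> x = y,
      forall x y, d x y = d y x &
      forall x y z, d x z <= d x y + d y z].

Definition homogeneous_distance (R : realType) (G : topGroupType)
    (delta : R -> G -> G) (d : G -> G -> R) : Prop :=
  [/\ is_metric d,
      forall g h k : G, d (g * h)%g (g * k)%g = d h k &
      forall (l : R) (g h : G), 0 < l -> d (delta l g) (delta l h) = l * d g h].

Definition projection_norm (R : realType) (n : nat) (G : topGroupType)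
    (exp : 'rV[R]_n -> G) (d : G -> G -> R) (X : 'rV[R]_n) : R :=
  d 1%g (exp X).

Definition strictly_convex (R : realType) (n : nat) (W : {vspace 'rV[R]_n})
    (N : 'rV[R]_n -> R) : Prop :=
  ~ exists X Y : 'rV[R]_n,
      [/\ X \in W, Y \in W, X <> Y &
          forall t : R, 0 <= t <= 1 -> N ((1 - t) *: X + t *: Y) = 1].

Definition infinite_geodesic (R : realType) (T : Type) (d : T -> T -> R)
    (f : R -> T) : Prop :=
  forall t s, d (f t) (f s) = `|t - s|.

Definition affine (R : realType) (n : nat) (G : topGroupType)
    (exp : 'rV[R]_n -> G) (f : R -> G) : Prop :=
  exists (g : G) (X : 'rV[R]_n), forall t, f t = (g * exp (t *: X))%g.

(* Main.v *)
Require Import Defs.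
From HB Require Import structures.
From mathcomp Require Import all_boot all_order all_algebra.
From mathcomp Require Import all_classical all_reals all_analysis.
From mathcomp Require Import ring lra.
Set Implicit Arguments.
Unset Strict Implicit.
Unset Printing Implicit Defensive.
Import Order.TTheory GRing.Theory Num.Theory.
Import numFieldNormedType.Exports.
Local Open Scope classical_set_scope.
Local Open Scope ring_scope.

(** Why the theorem is true.

    In exponential coordinates a stratified group of step 2 is V1 + V2 with the
    product (x, z)(y, w) = (x + y, z + w + [x, y]/2), and the distance is given
    by the homogeneous norm N(x, z) = d(1, exp(x + z)).  The first half of the
    file works with such an N on a pair of coordinate spaces.  An infinite
    geodesic has coordinates (x(t), z(t)); its horizontal part x is 1-Lipschitz
    for the projection norm, since N(x, z) >= N(x, 0) ([pnorm_le]).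

    The idea is to look for shortcuts.  Inserting a vector w into the geodesic
    at time t and giving it back at time 0 moves the endpoint by the vertical
    vector [x(t) - x(0), w] and costs a multiple of the norm of w.  Where x(t)
    goes far away, a fixed vertical displacement is therefore obtained at an
    arbitrarily small cost.  The infimum of the costs is a seminorm on V2; let E
    be its kernel.  Two things follow.  The displacements in E are free, so the
    geodesic still minimises the length modulo E ([quotient_minimizing]); and
    modulo E all the brackets [x(t) - x(s), y] are bounded by a multiple of the
    norm of y ([corr_projection], [bracket_bounded]).

    Because of this bound the vertical displacement modulo E grows at most
    linearly with time.  Replacing a piece of duration L by a straight segment
    then costs at most a multiple of sqrt L ([chord_defect]), so the chord has
    length at least L - K sqrt L, and arbitrarily far away there are long pieces
    of almost full chord length ([almost_straight_pieces]).  By strict convexity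
    these are close to lines, whose directions accumulate at some v with
    [v, V1] contained in E ([asymptotic_direction]).

    Suppose that some piece [s, s + h] does not have displacement h v.  A far,
    almost straight piece of duration h can be removed and its displacement h v
    spread uniformly over [s, s + h].  Strict convexity makes this a definite
    gain in length ([average_convexity_gap]).  As v is central modulo E, the
    vertical error modulo E comes only from subdividing, hence can be made as
    small as desired, and the part of the error in E is free: a contradiction
    ([ray_projection_line]).  So x is affine, and subdividing once more shows
    that the vertical part is the one of a line.

    The second half of the file reaches these coordinates from the axioms of a
    Lie group.  Two one-parameter subgroups with the same velocity agree
    ([ops_unique]), which gives exp(Ad g Y) = g exp(Y) g^-1, then
    Ad(exp X) Y = Y + [X, Y] when [X, [X, Y]] = 0, and finally the product
    formula exp X exp Y = exp(X + Y + [X, Y]/2) in step 2 ([exp_mul_step2]).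
    The exponential map is injective because of the dilations, and surjective
    because its image is an open subgroup of a connected group ([exp_near1],
    [exp_surj]). *)

(** * Compactness in finite dimension *)

Lemma mx_norm_coord (R : realType) n (x : 'rV[R]_n) i : `|x ord0 i| <= `|x|.
Proof.
rewrite [leRHS]/Num.norm /= mx_normrE; apply/bigmax_geP; right => /=.
by exists (ord0, i).
Qed.

Lemma unit_sphere_compact (R : realType) n : compact [set x : 'rV[R]_n | `|x| = 1].
Proof.
apply: bounded_closed_compact.
  by exists 1; split => // M M1 x /= ->; exact: ltW.
apply: (@closed_comp _ _ (fun x : 'rV[R]_n => `|x|) [set 1]).
  by move=> x _; exact: norm_continuous.
exact: closed_eq.
Qed.

Lemma uniform_continuous (R : realType) (V W : normedModType R) (f : V -> W) :
  (forall e : R, 0 < e -> exists2 r, 0 < r &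
     forall x y, `|x - y| <= r -> `|f x - f y| <= e) ->
  continuous f.
Proof.
move=> fu x; apply/cvgrPdist_le => e e0; have [r r0 fr] := fu e e0.
near=> y; apply: fr; near: y; exact: cvgr_dist_le.
Unshelve. all: by end_near. Qed.

Lemma sphere_lower_bound (R : realType) n (f : 'rV[R]_n -> R) :
  continuous f -> (forall x, `|x| = 1 -> 0 < f x) ->
  exists2 c, 0 < c & forall x, `|x| = 1 -> c <= f x.
Proof.
move=> cf f0.
have [[x0 x01]|nx] := pselect (exists x : 'rV[R]_n, `|x| = 1); last first.
  by exists 1 => // x x1; exfalso; apply: nx; exists x.
have [||c c1 cmin] := EVT_min_rV (A := [set x : 'rV[R]_n | `|x| = 1]) _
   (@unit_sphere_compact R n) (f := f).
- by exists x0.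
- exact: continuous_subspaceT.
- exists (f c); first by apply: f0; rewrite inE in c1.
  by move=> x x1; apply: cmin; rewrite inE.
Qed.

Lemma bounded_seq_cluster (R : realType) n (u : nat -> 'rV[R]_n) (K : R) :
  (forall i, `|u i| <= K) ->
  exists v, forall (e : R) j, 0 < e -> exists2 i, (j <= i)%N & `|u i - v| < e.
Proof.
move=> uK; pose D := [set x : 'rV[R]_n | `|x| <= K].
have cD : compact D.
  apply: bounded_closed_compact.
    by exists K; split; [exact: num_real|move=> M KM y /le_trans; apply; exact: ltW].
  apply: (@closed_comp _ _ (fun y : 'rV[R]_n => `|y|) [set y | y <= K]).
    by move=> y _; exact: norm_continuous.
  exact: closed_le.
have [|v [_ cv]] := cD (u @ \oo) (fmap_proper_filter u _); first by exists 0%N => //= i _; exact: uK.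
exists v => e j e0.
have [||_ [[i ji <-] /= vi]] := cv (u @` [set i | (j <= i)%N]) (ball v e).
- by exists j => // i /= ji; exists i.
- exact: nbhsx_ballx.
- by exists i => //; rewrite distrC; move: vi; rewrite -ball_normE.
Qed.

(** * Seminorms modulo their kernel *)

Lemma mulmx_bound (R : realType) n1 n2 (P : 'M[R]_(n1, n2)) :
  exists2 K, 0 < K & forall x : 'rV[R]_n1, `|x *m P| <= K * `|x|.
Proof.
exists (1 + \sum_i `|row i P|) => [|x]; first by rewrite ltr_pwDl// sumr_ge0.
rewrite mulmx_sum_row (le_trans (ler_norm_sum _ _ _))//.
rewrite mulrDl mul1r ler_wpDl// mulr_suml; apply: ler_sum => i _.
by rewrite normrZ mulrC ler_wpM2l// mx_norm_coord.
Qed.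

(** A seminorm is a norm on any complement of its kernel, where it dominates the
    ambient norm by compactness; the matrix [P] projects onto a complement along
    the kernel, so that [x *m P = 0] exactly when [p x = 0]. *)
Lemma seminorm_projection (R : realType) n (p : 'rV[R]_n -> R) :
  (forall x y, p (x + y) <= p x + p y) ->
  (forall a x, p (a *: x) = `|a| * p x) ->
  (forall x, p x <= `|x|) ->
  exists P : 'M[R]_n, (forall x, p (x - x *m P) = 0) /\
    exists2 K, 0 < K & forall x, `|x *m P| <= K * p x.
Proof.
move=> pD pZ p_le.
have p0 : p 0 = 0 by rewrite -(scale0r 0) pZ normr0 mul0r.
have pN x : p (- x) = p x by rewrite -scaleN1r pZ normrN1 mul1r.
have p_ge0 x : 0 <= p x by have := pD x (- x); rewrite pN subrr p0; lra.
have pB x y : `|p x - p y| <= p (x - y).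
  rewrite ler_distl; have := pD (x - y) y; have := pD (y - x) x.
  by rewrite !subrK -(pN (y - x)) opprB; lra.
(* a subspace of maximal rank on which [p] vanishes is the whole kernel *)
pose ok r := `[< exists U : 'M[R]_n, \rank U = r /\
  forall u : 'rV_n, (u <= U)%MS -> p u = 0 >].
have [||r /asboolP[U [rU Up]] rmax] := @ex_maxnP ok n.
- exists 0%N; apply/asboolP; exists 0; split; first exact: mxrank0.
  by move=> u; rewrite submx0 => /eqP ->.
- by move=> i /asboolP[U [<- _]]; exact: rank_leq_row.
have Uker u : p u = 0 -> (u <= U)%MS.
  move=> pu; have /rmax : ok (\rank (U + u)%MS).
    apply/asboolP; exists (U + u)%MS; split => // v /sub_addsmxP[[a b] /= ->].
    apply/eqP; rewrite eq_le p_ge0 andbT; apply: (le_trans (pD _ _)).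
    rewrite Up ?submxMl// add0r [b]mx11_scalar mul_scalar_mx pZ pu.
    by rewrite mulr0.
  move=> rle; have : (U + u <= U)%MS.
    by rewrite -(geq_leqif (mxrank_leqif_sup (addsmxSl U u))) rU.
  exact: submx_trans (addsmxSr _ _).
pose P := proj_mx (U^C)%MS U.
have dUC : (U^C :&: U = 0)%MS by rewrite capmxC; exact: capmx_compl.
have UCfull (x : 'rV_n) : (x <= U^C + U)%MS.
  by apply: submx_full; rewrite addsmxC; exact: addsmx_compl_full.
have PU (x : 'rV_n) : (x - x *m P <= U)%MS.
  rewrite -[X in (X - _ <= _)%MS](add_proj_mx dUC (UCfull x)) -/P addrC addKr.
  exact: proj_mx_sub.
have PC (x : 'rV_n) : (x *m P <= U^C)%MS by exact: proj_mx_sub.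
have PP (x : 'rV_n) : x *m P *m P = x *m P by rewrite [LHS]proj_mx_id.
exists P; split; first by move=> x; exact: Up.
have [KP KP0 HKP] := mulmx_bound P.
pose f x := p (x *m P) + `|x - x *m P|.
have cf : continuous f.
  apply: uniform_continuous => e e0; exists ((1 + 2 * KP)^-1 * e).
    by rewrite mulr_gt0// invr_gt0; lra.
  move=> x y; rewrite ler_pdivlMl; last by lra.
  move=> xy; apply: (le_trans _ xy); rewrite /f opprD addrACA.
  apply: (le_trans (ler_normD _ _)).
  have h1 := le_trans (pB (x *m P) (y *m P)) (p_le _).
  have h2 := le_trans (ler_dist_dist (x - x *m P) (y - y *m P))
    (lexx _).
  have h3 : `|x - x *m P - (y - y *m P)| <= `|x - y| + `|(x - y) *m P|.
    rewrite mulmxBl -[X in _ <= _ + X]normrN; apply: le_trans (ler_normD _ _).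
    by rewrite !opprD !opprK addrACA.
  have h4 := HKP (x - y); move: h1 h3 h4; rewrite mulmxBl; lra.
have [|c c0 Hc] := sphere_lower_bound cf.
  move=> x x1; rewrite lt_neqAle addr_ge0// andbT eq_sym paddr_eq0//.
  apply/negP => /andP[/eqP px0 ]; rewrite normr_eq0 subr_eq0 => /eqP xP.
  have xU : (x <= U)%MS by apply: Uker; rewrite xP.
  have : (x <= U^C :&: U)%MS by rewrite sub_capmx xU xP PC.
  rewrite dUC submx0 => /eqP x0.
  by move: x1; rewrite x0 normr0 => /eqP; rewrite eq_sym oner_eq0.
exists c^-1; first by rewrite invr_gt0.
move=> x; have [->|xP0] := eqVneq (x *m P) 0.
  by rewrite normr0 mulr_ge0// invr_ge0 ltW.
have xPp : 0 < `|x *m P| by rewrite normr_gt0.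
have := Hc (`|x *m P|^-1 *: (x *m P)).
rewrite normrZ normfV normr_id mulVf ?gt_eqF// => /(_ erefl).
rewrite /f -scalemxAl PP subrr normr0 addr0 pZ normfV normr_id ler_pdivlMl//.
move=> H; rewrite ler_pdivlMl// mulrC; apply: (le_trans H).
have := pD x (x *m P - x); rewrite (addrC x) subrK.
by rewrite -(pN (x *m P - x)) opprB (Up _ (PU x)) addr0.
Qed.

(** * Coordinates on a subspace *)

Section SubspaceCoordinates.
Context (R : realType) (n : nat) (U : {vspace 'rV[R]_n}).

Definition basis_comb (u : 'rV[R]_(\dim U)) : 'rV[R]_n :=
  \sum_i u ord0 i *: (vbasis U)`_i.

Lemma basis_comb_in u : basis_comb u \in U.
Proof. by apply: memv_suml => i _; rewrite memvZ// vbasis_mem// mem_nth ?size_tuple. Qed.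

Lemma basis_combP X : X \in U -> exists u, X = basis_comb u.
Proof.
move=> XU; exists (\row_i coord (vbasis U) i X).
by rewrite {1}(coord_vbasis XU); apply: eq_bigr => i _; rewrite mxE.
Qed.

Lemma basis_combD u w : basis_comb (u + w) = basis_comb u + basis_comb w.
Proof. by rewrite /basis_comb -big_split; apply: eq_bigr => i _; rewrite mxE scalerDl. Qed.

Lemma basis_combZ a u : basis_comb (a *: u) = a *: basis_comb u.
Proof. by rewrite /basis_comb scaler_sumr; apply: eq_bigr => i _; rewrite mxE scalerA. Qed.

Lemma basis_combN u : basis_comb (- u) = - basis_comb u.
Proof. by rewrite -scaleN1r basis_combZ scaleN1r. Qed.

Lemma basis_comb0 : basis_comb 0 = 0.
Proof. by rewrite -(scale0r 0) basis_combZ scale0r. Qed.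

Lemma basis_comb_eq0 u : basis_comb u = 0 -> u = 0.
Proof.
move=> u0; apply/rowP => i; rewrite mxE.
by have /freeP := basis_free (vbasisP U); apply; exact: u0.
Qed.

Lemma basis_comb_inj : injective basis_comb.
Proof.
move=> u w /eqP; rewrite -subr_eq0 -basis_combN -basis_combD => /eqP/basis_comb_eq0/eqP.
by rewrite subr_eq0 => /eqP.
Qed.

End SubspaceCoordinates.

(** * Homogeneous norms of step two *)

Record step2_bracket (R : realType) (m k : nat)
    (B : 'rV[R]_m -> 'rV[R]_m -> 'rV[R]_k) : Prop := Step2Bracket {
  brDl : forall x y z, B (x + y) z = B x z + B y z;
  brZl : forall a x z, B (a *: x) z = a *: B x z;
  br_anti : forall x y, B x y = - B y x }.

(** [N x z] stands for the distance from the identity to the element with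
    horizontal coordinates [x] and vertical coordinates [z]; [hn_sym] and
    [hn_mul] translate the symmetry and the triangle inequality of a
    left-invariant distance. *)
Record step2_norm (R : realType) (m k : nat)
    (B : 'rV[R]_m -> 'rV[R]_m -> 'rV[R]_k)
    (N : 'rV[R]_m -> 'rV[R]_k -> R) : Prop := Step2Norm {
  hn_bracket : step2_bracket B;
  hn0 : N 0 0 = 0;
  hn_eq0 : forall x z, N x z = 0 -> x = 0 /\ z = 0;
  hn_sym : forall x z, N (- x) (- z) = N x z;
  hn_mul : forall x y z w,
    N (x + y) (z + w + 2^-1 *: B x y) <= N x z + N y w;
  hn_dil : forall (l : R) x z, 0 < l -> N (l *: x) (l ^+ 2 *: z) = l * N x z }.

Section Bracket.
Context (R : realType) (m k : nat) (B : 'rV[R]_m -> 'rV[R]_m -> 'rV[R]_k).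
Hypothesis hB : step2_bracket B.

Lemma br_alt x : B x x = 0.
Proof.
apply/eqP; have /eqP := br_anti hB x x.
by rewrite -subr_eq0 opprK -mulr2n -scaler_nat scaler_eq0 pnatr_eq0.
Qed.

Lemma brDr x y z : B x (y + z) = B x y + B x z.
Proof. by rewrite (br_anti hB) (brDl hB) opprD -!(br_anti hB). Qed.

Lemma brZr a x y : B x (a *: y) = a *: B x y.
Proof. by rewrite (br_anti hB) (brZl hB) -scalerN -(br_anti hB). Qed.

Lemma brNl x y : B (- x) y = - B x y.
Proof. by rewrite -scaleN1r (brZl hB) scaleN1r. Qed.

Lemma brNr x y : B x (- y) = - B x y.
Proof. by rewrite -scaleN1r brZr scaleN1r. Qed.

Lemma brBl x y z : B (x - y) z = B x z - B y z.
Proof. by rewrite (brDl hB) brNl. Qed.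

Lemma brBr x y z : B x (y - z) = B x y - B x z.
Proof. by rewrite brDr brNr. Qed.

Lemma br0l y : B 0 y = 0.
Proof. by rewrite -(scale0r 0) (brZl hB) scale0r. Qed.

Lemma br0r y : B y 0 = 0.
Proof. by rewrite (br_anti hB) br0l oppr0. Qed.

Lemma br_suml I (r : seq I) (P : pred I) (F : I -> 'rV[R]_m) y :
  B (\sum_(i <- r | P i) F i) y = \sum_(i <- r | P i) B (F i) y.
Proof.
by apply: (big_morph (B ^~ y)) => [u v|]; [exact: (brDl hB)|exact: br0l].
Qed.

Lemma br_sumr I (r : seq I) (P : pred I) (F : I -> 'rV[R]_m) y :
  B y (\sum_(i <- r | P i) F i) = \sum_(i <- r | P i) B y (F i).
Proof.
by apply: (big_morph (B y)) => [u v|]; [exact: brDr|exact: br0r].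
Qed.

Lemma br_bound : exists2 K, 0 < K & forall x y, `|B x y| <= K * `|x| * `|y|.
Proof.
pose K := 1 + \sum_i \sum_j `|B (delta_mx ord0 i) (delta_mx ord0 j)|.
exists K => [|x y].
  by rewrite ltr_pwDl// sumr_ge0// => i _; rewrite sumr_ge0.
rewrite {1}(row_sum_delta x) br_suml (le_trans (ler_norm_sum _ _ _))//.
apply: (@le_trans _ _ (\sum_i \sum_j
   `|B (delta_mx ord0 i) (delta_mx ord0 j)| * (`|x| * `|y|))).
  apply: ler_sum => i _; rewrite (brZl hB) {1}(row_sum_delta y) br_sumr.
  rewrite scaler_sumr (le_trans (ler_norm_sum _ _ _))//; apply: ler_sum => j _.
  rewrite brZr scalerA normrZ mulrC ler_wpM2l// normrM.
  by rewrite ler_pM// mx_norm_coord.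
under eq_bigr do rewrite -mulr_suml.
rewrite -mulr_suml -mulrA ler_wpM2r ?mulr_ge0//.
by rewrite /K lerDr.
Qed.

End Bracket.

Section Norm.
Context (R : realType) (m k : nat) (B : 'rV[R]_m -> 'rV[R]_m -> 'rV[R]_k).
Context (N : 'rV[R]_m -> 'rV[R]_k -> R).
Hypothesis hN : step2_norm B N.
Let hB := hn_bracket hN.

Local Notation pnorm x := (N x 0).
Local Notation vnorm z := (N 0 z).

Lemma hn_ge0 x z : 0 <= N x z.
Proof.
have := hn_mul hN x (- x) z (- z).
rewrite !subrr (brNr hB) (br_alt hB) oppr0 scaler0 addr0 (hn0 hN) (hn_sym hN).
lra.
Qed.

Lemma hn_dil0 (l : R) x z : 0 <= l -> N (l *: x) (l ^+ 2 *: z) = l * N x z.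
Proof.
rewrite le_eqVlt => /predU1P[<-|l0]; last exact: (hn_dil hN).
by rewrite expr0n/= !scale0r mul0r (hn0 hN).
Qed.

(** Vertical elements are central, so appending one changes no bracket. *)
Lemma hn_vert x z w : N x (z + w) <= N x z + vnorm w.
Proof.
by have := hn_mul hN x 0 z w; rewrite addr0 (br0r hB) scaler0 addr0.
Qed.

Lemma hn_vertN x z w : N x z <= N x (z + w) + vnorm w.
Proof.
have := hn_vert x (z + w) (- w); rewrite addrK.
by rewrite -[in N 0 (- w)](oppr0) (hn_sym hN).
Qed.

Lemma hn_iter x z j : N (x *+ j) (z *+ j) <= N x z *+ j.
Proof.
elim: j => [|j IH]; first by rewrite !mulr0n (hn0 hN).
rewrite !mulrSr; apply: le_trans (lerD IH (lexx _)).
have := hn_mul hN (x *+ j) x (z *+ j) z.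
suff -> : B (x *+ j) x = 0 by rewrite scaler0 addr0.
by rewrite -scaler_nat (brZl hB) (br_alt hB) scaler0.
Qed.

Lemma vnorm_dil (l : R) z : 0 <= l -> vnorm (l ^+ 2 *: z) = l * vnorm z.
Proof. by move=> l0; rewrite -{1}(scaler0 _ l) hn_dil0. Qed.

(** The j-th power of (x, z) is (j x, j z), which a dilation brings back to
    (x, z/j); letting j grow removes the vertical coordinate without increasing
    the norm. *)
Lemma pnorm_le x z : pnorm x <= N x z.
Proof.
apply/ler_addgt0Pr => e e0.
(* the power [j ^ 2] divides the norm of the vertical part by exactly [j] *)
pose j := (Num.truncn (vnorm z / e)).+1.
have j0 : 0 < j%:R :> R by rewrite ltr0n.
have zj : vnorm z < j%:R * e.
  by rewrite -ltr_pdivrMr// /j truncnS_gt.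
have H1 : N x ((j%:R ^- 2) *: z) <= N x z.
  have := hn_iter x z (j ^ 2).
  rewrite -[N x z *+ _]mulr_natl natrX.
  have -> : N (x *+ (j ^ 2)) (z *+ (j ^ 2)) =
     j%:R ^+ 2 * N x ((j%:R ^- 2) *: z).
    rewrite -(hn_dil0 x _ (sqr_ge0 j%:R)) scalerA -(scaler_nat _ x) -(scaler_nat _ z) natrX.
    congr (N _ (_ *: _)).
    by rewrite [in RHS]expr2 mulfK// expf_eq0 pnatr_eq0.
  by rewrite ler_pM2l// exprn_gt0.
apply: le_trans (lerD H1 (lexx e)).
have := hn_vertN x 0 (j%:R ^- 2 *: z); rewrite add0r.
rewrite -exprVn vnorm_dil ?invr_ge0 ?ler0n// => H2.
apply: (le_trans H2); rewrite lerD// ler_pdivrMl//; exact: ltW.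
Qed.

Lemma pnormD x y : pnorm (x + y) <= pnorm x + pnorm y.
Proof.
apply: (le_trans (pnorm_le _ (2^-1 *: B x y))).
by have := hn_mul hN x y 0 0; rewrite !add0r.
Qed.

Lemma pnormN x : pnorm (- x) = pnorm x.
Proof. by rewrite -{1}(oppr0 _) (hn_sym hN). Qed.

Lemma pnormZ (a : R) x : pnorm (a *: x) = `|a| * pnorm x.
Proof.
have H b : 0 <= b -> pnorm (b *: x) = b * pnorm x.
  by move=> b0; rewrite -hn_dil0// scaler0.
have [a0|a0] := leP 0 a; first by rewrite ger0_norm// H.
by rewrite ltr0_norm// -H ?oppr_ge0 ?ltW// scaleNr pnormN.
Qed.

Lemma pnormB x y : pnorm (x - y) = pnorm (y - x).
Proof. by rewrite -pnormN opprB. Qed.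

Lemma pnorm_sum I (r : seq I) (P : pred I) (F : I -> 'rV[R]_m) :
  pnorm (\sum_(i <- r | P i) F i) <= \sum_(i <- r | P i) pnorm (F i).
Proof.
elim/big_ind2 : _ => //; first by rewrite (hn0 hN).
by move=> x a y b ha hb; exact: le_trans (pnormD _ _) (lerD ha hb).
Qed.

Lemma vnormD z w : vnorm (z + w) <= vnorm z + vnorm w.
Proof. exact: hn_vert. Qed.

Lemma vnormN z : vnorm (- z) = vnorm z.
Proof. by rewrite -[in LHS](oppr0 _) (hn_sym hN). Qed.

Lemma vnorm_sum I (r : seq I) (P : pred I) (F : I -> 'rV[R]_k) :
  vnorm (\sum_(i <- r | P i) F i) <= \sum_(i <- r | P i) vnorm (F i).
Proof.
elim/big_ind2 : _ => //; first by rewrite (hn0 hN).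
by move=> x a y b ha hb; exact: le_trans (vnormD _ _) (lerD ha hb).
Qed.

Lemma pnorm_bound : exists2 K, 0 < K & forall x, pnorm x <= K * `|x|.
Proof.
exists (1 + \sum_i pnorm (delta_mx ord0 i)) => [|x].
  by rewrite ltr_pwDl// sumr_ge0// => i _; exact: hn_ge0.
rewrite {1}(row_sum_delta x) (le_trans (pnorm_sum _ _ _))//.
rewrite mulrDl mul1r ler_wpDl// mulr_suml; apply: ler_sum => i _.
rewrite pnormZ mulrC ler_wpM2l ?hn_ge0//; exact: mx_norm_coord.
Qed.

(** Vertical vectors are scaled quadratically by the dilations, whence the square
    root. *)
Lemma vnorm_bound : exists2 K, 0 < K &
  forall z, vnorm z <= K * Num.sqrt `|z|.
Proof.
exists (1 + \sum_i vnorm (delta_mx ord0 i)) => [|x].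
  by rewrite ltr_pwDl// sumr_ge0// => i _; exact: hn_ge0.
rewrite {1}(row_sum_delta x) (le_trans (vnorm_sum _ _ _))//.
rewrite mulrDl mul1r ler_wpDl ?sqrtr_ge0// mulr_suml; apply: ler_sum => i _.
have -> : vnorm (x ord0 i *: delta_mx ord0 i) =
   Num.sqrt `|x ord0 i| * vnorm (delta_mx ord0 i).
  rewrite -vnorm_dil ?sqrtr_ge0// sqr_sqrtr//.
  have [a0|a0] := leP 0 (x ord0 i); first by rewrite ger0_norm.
  by rewrite ltr0_norm// scaleNr vnormN.
rewrite mulrC ler_wpM2l ?hn_ge0// ler_wsqrtr//; exact: mx_norm_coord.
Qed.

Lemma pnorm_dist x y : `|pnorm x - pnorm y| <= pnorm (x - y).
Proof.
rewrite ler_distl; have := pnormD (x - y) y; have := pnormD (y - x) x.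
rewrite !subrK (pnormB y x); lra.
Qed.

Lemma vnorm_dist x y : `|vnorm x - vnorm y| <= vnorm (x - y).
Proof.
rewrite ler_distl; have := vnormD (x - y) y; have := vnormD (y - x) x.
rewrite !subrK -(vnormN (y - x)) opprB; lra.
Qed.

Lemma pnorm_continuous : continuous (fun x => pnorm x).
Proof.
have [K K0 HK] := pnorm_bound.
apply: uniform_continuous => e e0; exists (K^-1 * e).
  by rewrite mulr_gt0 ?invr_gt0.
move=> x y xy; apply: (le_trans (pnorm_dist _ _)); apply: (le_trans (HK _)).
by rewrite -ler_pdivlMl.
Qed.

Lemma vnorm_continuous : continuous (fun x => vnorm x).
Proof.
have [K K0 HK] := vnorm_bound.
apply: uniform_continuous => e e0; exists ((K^-1 * e) ^+ 2).
  by rewrite exprn_gt0// mulr_gt0 ?invr_gt0.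
move=> x y xy; apply: (le_trans (vnorm_dist _ _)); apply: (le_trans (HK _)).
have Ke : 0 <= K^-1 * e by rewrite mulr_ge0 ?invr_ge0 ?ltW.
by rewrite -ler_pdivlMl// -[leRHS]ger0_norm// -sqrtr_sqr ler_wsqrtr.
Qed.

Lemma pnorm_lower : exists2 K, 0 < K & forall x, `|x| <= K * pnorm x.
Proof.
have [|c c0 Hc] := sphere_lower_bound pnorm_continuous.
  move=> x x1; rewrite lt_neqAle hn_ge0 andbT eq_sym; apply/eqP => /(hn_eq0 hN)[x0 _].
  by move: x1; rewrite x0 normr0 => /eqP; rewrite eq_sym oner_eq0.
exists c^-1 => [|x]; first by rewrite invr_gt0.
have [->|x0] := eqVneq x 0; first by rewrite normr0 mulr_ge0 ?hn_ge0 ?invr_ge0 ?ltW.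
have xp : 0 < `|x| by rewrite normr_gt0.
have := Hc (`|x|^-1 *: x); rewrite normrZ normfV normr_id mulVf ?gt_eqF//.
move=> /(_ erefl); rewrite pnormZ normfV normr_id ler_pdivlMl// => H.
by rewrite ler_pdivlMl// mulrC.
Qed.

Lemma vnorm_lower : exists2 K, 0 < K & forall z, `|z| <= K * vnorm z ^+ 2.
Proof.
have [|c c0 Hc] := sphere_lower_bound vnorm_continuous.
  move=> x x1; rewrite lt_neqAle hn_ge0 andbT eq_sym; apply/eqP => /(hn_eq0 hN)[_ x0].
  by move: x1; rewrite x0 normr0 => /eqP; rewrite eq_sym oner_eq0.
exists (c ^- 2) => [|x]; first by rewrite invr_gt0 exprn_gt0.
have [->|x0] := eqVneq x 0.
  by rewrite normr0 mulr_ge0 ?sqr_ge0// invr_ge0 sqr_ge0.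
have xp : 0 < `|x| by rewrite normr_gt0.
have := Hc (`|x|^-1 *: x); rewrite normrZ normfV normr_id mulVf ?gt_eqF//.
move=> /(_ erefl).
have <- : (Num.sqrt `|x|)^-1 ^+ 2 = `|x|^-1 by rewrite exprVn sqr_sqrtr.
rewrite vnorm_dil ?invr_ge0 ?sqrtr_ge0// ler_pdivlMl ?sqrtr_gt0// => H.
rewrite ler_pdivlMl ?exprn_gt0// -[X in _ * X](@sqr_sqrtr _ `|x|)//.
rewrite mulrC -exprMn; apply: lerXn2r => //; rewrite nnegrE ?hn_ge0//.
by rewrite mulr_ge0 ?sqrtr_ge0// ltW.
Qed.

End Norm.

(** * Uniform convexity *)

Section StrictConvexity.
Context (R : realType) (m k : nat) (B : 'rV[R]_m -> 'rV[R]_m -> 'rV[R]_k).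
Context (N : 'rV[R]_m -> 'rV[R]_k -> R).
Hypothesis hN : step2_norm B N.
Local Notation pnorm x := (N x 0).

Hypothesis hconv : ~ exists X Y : 'rV[R]_m, X <> Y /\
  forall t : R, 0 <= t <= 1 -> pnorm ((1 - t) *: X + t *: Y) = 1.

(** A convex function that is at most 1 on a segment and equals 1 at its midpoint
    is 1 on the whole segment. *)
Lemma midpoint_sphere_segment (a b : 'rV[R]_m) :
  pnorm a <= 1 -> pnorm b <= 1 -> 2 <= pnorm (a + b) ->
  forall t : R, 0 <= t <= 1 -> pnorm ((1 - t) *: a + t *: b) = 1.
Proof.
move=> a1 b1 ab t /andP[t0 t1].
pose p s := (1 - s) *: a + s *: b.
have le1 s : 0 <= s -> s <= 1 -> pnorm (p s) <= 1.
  move=> s0 s1; rewrite /p; apply: (le_trans (pnormD hN _ _)).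
  rewrite !(pnormZ hN) !ger0_norm ?subr_ge0//.
  have := ler_wpM2l s0 b1.
  have : (1 - s) * pnorm a <= (1 - s) * 1 by rewrite ler_wpM2l// subr_ge0.
  lra.
(* the point symmetric to [p t] completes it to [a + b] *)
apply/eqP; rewrite eq_le le1//=.
have : pnorm (a + b) <= pnorm (p t) + pnorm (p (1 - t)).
  apply: le_trans (pnormD hN _ _); rewrite le_eqVlt; apply/orP; left.
  by apply/eqP; congr (N _ _); apply/rowP => i; rewrite !mxE; ring.
have : pnorm (p (1 - t)) <= 1 by apply: le1; lra.
by rewrite -/(p t); lra.
Qed.

(** In finite dimension strict convexity is uniform: the set of pairs of points of
    the unit ball at distance at least [r] is compact. *)
Lemma uniform_convexity (r : R) : 0 < r -> exists2 eta, 0 < eta &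
  forall a b, pnorm a <= 1 -> pnorm b <= 1 -> r <= `|a - b| ->
    pnorm (a + b) <= 2 - eta.
Proof.
move=> r0; pose D := [set a : 'rV[R]_m | pnorm a <= 1].
have chn := @pnorm_continuous _ _ _ _ _ hN.
have cD : compact D.
  apply: bounded_closed_compact.
    have [K K0 HK] := pnorm_lower hN.
    exists K; split; first exact: num_real.
    move=> M KM x Dx /=; apply: le_trans (HK x) _; apply: le_trans (ltW KM).
    by rewrite ger_pMr.
  apply: (@closed_comp _ _ (fun x : 'rV[R]_m => pnorm x) [set y | y <= 1]).
    by move=> x _; exact: chn.
  exact: closed_le.
pose S := (D `*` D) `&` [set p : 'rV[R]_m * 'rV[R]_m | r <= `|p.1 - p.2|].
have cS : compact S.
  apply: compact_closedI; first exact: compact_setX.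
  apply: (@closed_comp _ _ (fun p : 'rV[R]_m * 'rV[R]_m => `|p.1 - p.2|)
    [set y | r <= y]).
    move=> p _; apply: cvg_norm; apply: cvgB; [exact: cvg_fst|exact: cvg_snd].
  exact: closed_ge.
have [S0|/set0P/negP] := pselect (S !=set0); last first.
  rewrite negbK => /eqP Se; exists 1 => // a b a1 b1 rab.
  suff : S (a, b) by rewrite Se.
  by [].
pose f (p : 'rV[R]_m * 'rV[R]_m) := 2 - pnorm (p.1 + p.2).
have cf : continuous f.
  move=> p; apply: cvgB; first exact: cvg_cst.
  apply: (@continuous_comp _ _ _ (fun p : 'rV[R]_m * 'rV[R]_m => p.1 + p.2)
    (fun x => pnorm x)); last exact: chn.
  by apply: cvgD; [exact: cvg_fst|exact: cvg_snd].
have [[a0 b0]] := compact_EVT_min S0 cS (continuous_subspaceT cf).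
rewrite inE => -[[/= a01 b01] rab0] fmin.
exists (f (a0, b0)) => [|a b a1 b1 rab].
  rewrite /f /= subr_gt0 ltNge; apply/negP => h2.
  apply: hconv; exists a0, b0; split; last exact: midpoint_sphere_segment.
  by move=> ab; move: rab0; rewrite ab subrr normr0 leNgt r0.
have := fmin (a, b); rewrite inE => /(_ (conj (conj a1 b1) rab)).
by rewrite /f /=; lra.
Qed.

End StrictConvexity.

(** * The seminorm of vertical corrections *)

Section Correction.
Context (R : realType) (m k : nat) (B : 'rV[R]_m -> 'rV[R]_m -> 'rV[R]_k).
Hypothesis hB : step2_bracket B.
Context (p : nat -> 'rV[R]_m).

(** Inserting [w j] into a curve at the point [p j] produces the vertical vector
    [B (p j) (w j)].  The cost counts the inserted vectors and what remains of
    [e]; charging the remainder makes the cost finite for every [e]. *)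
Definition corr_cost n (w : nat -> 'rV[R]_m) (e : 'rV[R]_k) : R :=
  \sum_(0 <= j < n) `|w j| + `|e - \sum_(0 <= j < n) B (p j) (w j)|.

Definition corr_inf e : R :=
  inf [set r | exists n w, r = corr_cost n w e].

Lemma corr_cost_ge0 n w e : 0 <= corr_cost n w e.
Proof. by rewrite addr_ge0// sumr_ge0. Qed.

Lemma corr_inf_le n w e : corr_inf e <= corr_cost n w e.
Proof.
apply: ge_inf; last by exists n, w.
by exists 0 => _ [n' [w' ->]]; exact: corr_cost_ge0.
Qed.

Lemma corr_inf_adherent e (d : R) : 0 < d ->
  exists n w, corr_cost n w e < corr_inf e + d.
Proof.
move=> d0; have [|_ [n [w ->]] h] := @inf_adherent _
  [set r | exists n w, r = corr_cost n w e] d d0.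
  split; first by exists (corr_cost 0 (fun=> 0) e); exists 0%N, (fun=> 0).
  by exists 0 => _ [n' [w' ->]]; exact: corr_cost_ge0.
by exists n, w.
Qed.

Lemma corr_cost_widen n n' w : (n <= n')%N -> exists w',
  forall e, corr_cost n' w' e = corr_cost n w e.
Proof.
move=> nn'; exists (fun j => if (j < n)%N then w j else 0) => e.
rewrite /corr_cost !(@big_cat_nat _ _ _ n 0 n')//=.
have bigw (V : zmodType) (F : nat -> 'rV[R]_m -> V) :
    (forall j, F j 0 = 0) ->
    \sum_(0 <= i < n) F i (if (i < n)%N then w i else 0) +
    \sum_(n <= i < n') F i (if (i < n)%N then w i else 0) =
    \sum_(0 <= i < n) F i (w i).
  move=> F0; rewrite [X in _ + X]big1_seq ?addr0; last first.
    by move=> i /andP[_]; rewrite mem_index_iota => /andP[ni _]; rewrite ltnNge ni.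
  by apply: eq_big_nat => i /andP[_ ->].
rewrite (bigw _ (fun _ u => `|u|))//; last by move=> j; rewrite normr0.
by rewrite (bigw _ (fun j u => B (p j) u))// => j; rewrite (br0r hB).
Qed.

Lemma corr_infD x y : corr_inf (x + y) <= corr_inf x + corr_inf y.
Proof.
apply/ler_addgt0Pr => e e0.
have e20 : 0 < e / 2 by lra.
have [n1 [w1 h1]] := corr_inf_adherent x e20.
have [n2 [w2 h2]] := corr_inf_adherent y e20.
have [v1 hv1] := corr_cost_widen w1 (leq_maxl n1 n2).
have [v2 hv2] := corr_cost_widen w2 (leq_maxr n1 n2).
rewrite -hv1 in h1; rewrite -hv2 in h2.
apply: (le_trans (corr_inf_le (maxn n1 n2) (fun j => v1 j + v2 j) _)).
suff : corr_cost (maxn n1 n2) (fun j => v1 j + v2 j) (x + y) <=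
  corr_cost (maxn n1 n2) v1 x + corr_cost (maxn n1 n2) v2 y by lra.
rewrite /corr_cost addrACA lerD//.
  by rewrite -big_split /=; apply: ler_sum => i _; exact: ler_normD.
under eq_bigr do rewrite (brDr hB).
by rewrite big_split /= opprD addrACA ler_normD.
Qed.

Lemma corr_infZ a x : corr_inf (a *: x) = `|a| * corr_inf x.
Proof.
have corr_inf0 : corr_inf 0 = 0.
  apply/eqP; rewrite eq_le; apply/andP; split.
    apply: le_trans (corr_inf_le 0 (fun=> 0) 0) _.
    by rewrite /corr_cost !big_geq// subrr normr0 addr0.
  apply: lb_le_inf; first by exists (corr_cost 0 (fun=> 0) 0); exists 0%N, (fun=> 0).
  by move=> _ [n [w ->]]; exact: corr_cost_ge0.
have le1 b y : b != 0 -> corr_inf (b *: y) <= `|b| * corr_inf y.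
  move=> b0; have bp : 0 < `|b| by rewrite normr_gt0.
  rewrite -ler_pdivrMl//; apply/ler_addgt0Pr => e e0.
  have [n [w h]] := corr_inf_adherent y e0.
  rewrite ler_pdivrMl//; apply: (le_trans (corr_inf_le n (fun j => b *: w j) _)).
  have -> : corr_cost n (fun j => b *: w j) (b *: y) = `|b| * corr_cost n w y.
    rewrite /corr_cost mulrDr mulr_sumr -normrZ scalerBr scaler_sumr.
    congr +%R; first by apply: eq_bigr => i _; rewrite normrZ.
    congr (Num.norm (b *: y - _)).
    by apply: eq_bigr => i _; rewrite (brZr hB).
  by rewrite ler_pM2l// ltW.
have [->|a0] := eqVneq a 0; first by rewrite scale0r normr0 mul0r.
apply/eqP; rewrite eq_le le1//=.
have := le1 a^-1 (a *: x); rewrite invr_eq0 scalerA mulVf// scale1r => /(_ a0).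
by rewrite normfV ler_pdivlMl ?normr_gt0// mulrC.
Qed.

(** The vertical vectors in the kernel of [P] are those that can be produced at
    arbitrarily small cost: it is the kernel of the seminorm [corr_inf].  A bracket [B (p j) y] costs at most the norm of [y],
    hence is bounded modulo this kernel, however large [p j] is. *)
Lemma corr_projection : exists P : 'M[R]_k,
  [/\ forall e : 'rV[R]_k, (e - e *m P) *m P = 0,
      forall (e : 'rV[R]_k) (d : R), e *m P = 0 -> 0 < d -> exists n w, corr_cost n w e < d &
      exists2 K, 0 < K & forall j y, `|B (p j) y *m P| <= K * `|y|].
Proof.
have c_le e : corr_inf e <= `|e|.
  apply: (le_trans (corr_inf_le 0 (fun=> 0) e)).
  by rewrite /corr_cost !big_geq// subr0 add0r.
have [P [P0 [K K0 HK]]] := seminorm_projection corr_infD corr_infZ c_le.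
exists P; split.
- move=> e; apply/eqP; rewrite -normr_le0.
  by apply: le_trans (HK _) _; rewrite P0 mulr0.
- move=> e d eP d0; have [n [w h]] := corr_inf_adherent e d0.
  by exists n, w; move: h (P0 e); rewrite eP subr0 => h0 E; rewrite E add0r in h0.
- exists K => // j y; apply: (le_trans (HK _)); rewrite ler_pM2l//.
  apply: (le_trans (corr_inf_le j.+1 (fun i => if i == j then y else 0) _)).
  rewrite /corr_cost !big_nat_recr//= eqxx big_nat big1 ?add0r; last first.
    by move=> i /andP[_ ij]; rewrite lt_eqF// normr0.
  rewrite big_nat big1 ?add0r ?subrr ?normr0 ?addr0// => i /andP[_ ij].
  by rewrite lt_eqF// (br0r hB).
Qed.

End Correction.

(** * Geodesics of a homogeneous norm *)

(** The vertical coordinate of the inverse of (x s, z s) times (x t, z t). *)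
Definition vdisp (R : realType) (m k : nat)
    (B : 'rV[R]_m -> 'rV[R]_m -> 'rV[R]_k)
    (x : R -> 'rV[R]_m) (z : R -> 'rV[R]_k) (s t : R) : 'rV[R]_k :=
  z t - z s - 2^-1 *: B (x s) (x t).

Definition norm_geodesic (R : realType) (m k : nat)
    (B : 'rV[R]_m -> 'rV[R]_m -> 'rV[R]_k) (N : 'rV[R]_m -> 'rV[R]_k -> R)
    (x : R -> 'rV[R]_m) (z : R -> 'rV[R]_k) : Prop :=
  forall s t, N (x t - x s) (vdisp B x z s t) = `|t - s|.

Section Geodesic.
Context (R : realType) (m k : nat) (B : 'rV[R]_m -> 'rV[R]_m -> 'rV[R]_k).
Context (N : 'rV[R]_m -> 'rV[R]_k -> R).
Hypothesis hN : step2_norm B N.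
Let hB := hn_bracket hN.
Local Notation pnorm x := (N x 0).
Local Notation vnorm z := (N 0 z).
Let brE := (brDl hB, brDr hB, brNl hB, brNr hB, brZl hB, brZr hB).

Context (x : R -> 'rV[R]_m) (z : R -> 'rV[R]_k).
Local Notation vd := (vdisp B x z).

Lemma vdisp_cat s t u :
  vd s u = vd s t + vd t u + 2^-1 *: B (x t - x s) (x u - x t).
Proof.
rewrite /vdisp !brE (br_alt hB (x t)).
by apply/rowP => i; rewrite !mxE; lra.
Qed.

Lemma vdispxx s : vd s s = 0.
Proof. by rewrite /vdisp (br_alt hB) scaler0 subr0 subrr. Qed.

(** Vertical displacements add up, except for the bracket of the position
    reached with the next horizontal step. *)
Lemma vdisp_subdiv (tau : nat -> R) n :
  vd (tau 0) (tau n) = \sum_(0 <= i < n) vd (tau i) (tau i.+1) +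
    2^-1 *: \sum_(0 <= i < n) B (x (tau i) - x (tau 0)) (x (tau i.+1) - x (tau i)).
Proof.
elim: n => [|n IH]; first by rewrite !big_geq// vdispxx scaler0 addr0.
rewrite !big_nat_recr//= (vdisp_cat _ (tau n)) IH scalerDr.
by rewrite (addrAC _ _ (vd _ _)) -!addrA.
Qed.

Hypothesis hgeo : norm_geodesic B N x z.

Lemma pnorm_geo s t : pnorm (x t - x s) <= `|t - s|.
Proof. by rewrite -hgeo; exact: (pnorm_le hN). Qed.

Lemma geo_lipschitz : exists2 K, 0 < K & forall s t, `|x t - x s| <= K * `|t - s|.
Proof.
have [K K0 HK] := pnorm_lower hN; exists K => // s t.
by apply: (le_trans (HK _)); rewrite ler_pM2l// pnorm_geo.
Qed.

(** The vertical part of a piece of duration t has norm at most 2 t, and vertical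
    vectors of norm r have size of order r^2.  This quadratic bound is what makes
    fine subdivisions kill the vertical displacements of the pieces. *)
Lemma vdisp_bound : exists2 K, 0 < K & forall s t, `|vd s t| <= K * (t - s) ^+ 2.
Proof.
have [K K0 HK] := vnorm_lower hN; exists (K * 4); first by lra.
move=> s t; apply: (le_trans (HK _)); rewrite -mulrA ler_pM2l//.
have h : vnorm (vd s t) <= 2 * `|t - s|.
  have := hn_mul hN (- (x t - x s)) (x t - x s) 0 (vd s t).
  rewrite add0r addNr (brNl hB) (br_alt hB) oppr0 scaler0 addr0 hgeo (pnormN hN).
  by have := pnorm_geo s t; lra.
rewrite -(@real_normK _ (t - s)) ?num_real//.
apply: (@le_trans _ _ ((2 * `|t - s|) ^+ 2)); last by rewrite exprMn; lra.
by apply: lerXn2r => //; rewrite nnegrE ?(hn_ge0 hN)// mulr_ge0.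
Qed.

(** The curve through the points of the geodesic at the times [T0 + i], modified by
    inserting [w i] at the time [T0 + i]. *)
Lemma insertion_aux (T0 : R) (w : nat -> 'rV[R]_m) l :
  let q := fun i : nat => x (T0 + i%:R) - x T0 in
  let W := fun i => \sum_(0 <= j < i) w j in
  is_true (  N (q l + W l) (vd T0 (T0 + l%:R) + \sum_(0 <= i < l) B (q i) (w i) +
     2^-1 *: B (W l) (q l) + 2^-1 *: \sum_(0 <= i < l) B (W i) (w i))
  <= l%:R + \sum_(0 <= i < l) pnorm (w i)).
Proof.
move=> q W; elim: l => [|l IH].
  rewrite /W /q !big_geq// !addr0 subrr vdispxx (br0r hB) scaler0 !addr0.
  by rewrite (hn0 hN).
set Z := (X in N _ X) in IH.
pose xi := x (T0 + l.+1%:R) - x (T0 + l%:R).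
pose ze := vd (T0 + l%:R) (T0 + l.+1%:R).
have lS : T0 + l.+1%:R - (T0 + l%:R) = 1 :> R by rewrite -[l.+1]addn1 natrD; ring.
have h1 := hn_mul hN (q l + W l) (w l) Z 0.
have h2 := hn_mul hN (q l + W l + w l) xi (Z + 0 + 2^-1 *: B (q l + W l) (w l)) ze.
have h3 : N xi ze = 1 by rewrite hgeo lS normr1.
have -> : q l.+1 + W l.+1 = q l + W l + w l + xi.
  rewrite /W big_nat_recr//= -/(W l) /q /xi.
  by apply/rowP => i; rewrite !mxE; ring.
set Z' := (X in N _ X <= _).
have -> : Z' = Z + 0 + 2^-1 *: B (q l + W l) (w l) + ze +
   2^-1 *: B (q l + W l + w l) xi.
  rewrite /Z' /Z !big_nat_recr//= (vdisp_cat T0 (T0 + l%:R)) -/ze -/xi -/(q l).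
  have -> : W l.+1 = W l + w l by rewrite /W big_nat_recr.
  have -> : q l.+1 = q l + xi by rewrite /q /xi; apply/rowP => i; rewrite !mxE; ring.
  clearbody q W xi ze; rewrite !brE (br_anti hB (w l) (q l)).
  by apply/rowP => i; rewrite !mxE; lra.
apply: (le_trans h2); rewrite h3.
rewrite big_nat_recr//= -[in l.+1%:R]addn1 natrD.
by move: h1 IH; lra.
Qed.

(** Giving back the total translation [W l] at the time [T0] closes the horizontal
    part; the remaining vertical displacement is linear in [w] up to a sum of
    brackets that is quadratic in [w]. *)
Lemma insertion (T0 : R) (w : nat -> 'rV[R]_m) l :
  let q := fun i : nat => x (T0 + i%:R) - x T0 in
  let W := fun i => \sum_(0 <= j < i) w j in
  is_true (  N (q l) (vd T0 (T0 + l%:R) + \sum_(0 <= i < l) B (q i) (w i) +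
     2^-1 *: \sum_(0 <= i < l) B (W i) (w i))
  <= l%:R + 2 * \sum_(0 <= i < l) pnorm (w i)).
Proof.
move=> q W.
pose Z := vd T0 (T0 + l%:R) + \sum_(0 <= i < l) B (q i) (w i) +
     2^-1 *: B (W l) (q l) + 2^-1 *: \sum_(0 <= i < l) B (W i) (w i).
have h : N (q l + W l) Z <= l%:R + \sum_(0 <= i < l) pnorm (w i).
  exact: insertion_aux.
have h1 := hn_mul hN (- W l) (q l + W l) 0 Z.
have h2 : pnorm (- W l) <= \sum_(0 <= i < l) pnorm (w i).
  by rewrite (pnormN hN); exact: (pnorm_sum hN).
set Z' := (X in N _ X <= _).
have -> : q l = - W l + (q l + W l) by rewrite addrC addrK.
have -> : Z' = 0 + Z + 2^-1 *: B (- W l) (q l + W l).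
  rewrite /Z' /Z; clearbody q W; rewrite !brE (br_alt hB (W l)).
  by apply/rowP => i; rewrite !mxE; lra.
by apply: (le_trans h1); move: h h2; lra.
Qed.

End Geodesic.

(** * Free vertical corrections along a geodesic *)

Section Calibration.
Context (R : realType) (m k : nat) (B : 'rV[R]_m -> 'rV[R]_m -> 'rV[R]_k).
Context (N : 'rV[R]_m -> 'rV[R]_k -> R).
Hypothesis hN : step2_norm B N.
Let hB := hn_bracket hN.
Local Notation pnorm x := (N x 0).
Local Notation vnorm z := (N 0 z).
Context (x : R -> 'rV[R]_m) (z : R -> 'rV[R]_k).
Local Notation vd := (vdisp B x z).
Hypothesis hgeo : norm_geodesic B N x z.

Let p (j : nat) := x j%:R - x 0.

(** Free corrections remain free when only the times after [T0] may be used: the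
    vectors inserted before [T0] are short and paired with bounded positions.
    This keeps the corrections away from the part of the geodesic that is
    modified in a comparison. *)
Lemma tail_correction (e : 'rV[R]_k) (T0 : nat) :
  (forall d : R, 0 < d -> exists n w, corr_cost B p n w e < d) ->
  forall d : R, 0 < d -> exists l w, \sum_(0 <= i < l) `|w i| <= d /\
    `|e - \sum_(0 <= i < l) B (x (T0%:R + i%:R) - x T0%:R) (w i)| <= d.
Proof.
move=> He d d0.
have [KB KB0 HKB] := br_bound hB.
have [KL KL0 HKL] := geo_lipschitz hN hgeo.
(* dropping the times before [T0] and changing the base point from [x 0] to
   [x T0%:R] each modify the sum by at most [(C - 1)] times the cost *)
pose C := 1 + KB * (KL * T0%:R).
have C1 : 1 <= C by rewrite lerDl !mulr_ge0// ltW.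
have C0 : 0 < C by exact: lt_le_trans ltr01 C1.
have pT j : (j <= T0)%N -> `|p j| <= KL * T0%:R.
  move=> jT; apply: (le_trans (HKL _ _)); rewrite ler_pM2l// subr0.
  by rewrite ger0_norm// ler_nat.
have [n0 [w0 h0]] := He (d / C) (divr_gt0 d0 C0).
have [w hw] := corr_cost_widen hB p w0 (leq_addl T0 n0).
rewrite -{}hw {w0} in h0; set l := n0 in h0.
exists l, (fun i => w (i + T0)%N).
have split_sum (V : zmodType) (F : nat -> V) : \sum_(0 <= j < T0 + l) F j =
    \sum_(0 <= j < T0) F j + \sum_(0 <= i < l) F (i + T0)%N.
  rewrite (@big_cat_nat _ _ _ T0)//= ?leq_addr//; congr (_ + _).
  by rewrite -{1}(add0n T0) big_addn addKn.
move: h0; rewrite /corr_cost !split_sum => h0.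
set S1 := \sum_(0 <= i < T0) `|w i| in h0.
set S2 := \sum_(0 <= i < l) `|w (i + T0)%N| in h0 *.
set b1 := \sum_(0 <= j < T0) _ in h0.
set b2 := \sum_(0 <= i < l) _ in h0.
have S10 : 0 <= S1 by rewrite sumr_ge0.
have S20 : 0 <= S2 by rewrite sumr_ge0.
have hb1 : `|b1| <= KB * (KL * T0%:R) * S1.
  rewrite /b1 big_nat (le_trans (ler_norm_sum _ _ _))// /S1 [X in _ * X]big_nat.
  rewrite mulr_sumr; apply: ler_sum => i /andP[_ iT].
  apply: (le_trans (HKB _ _)); rewrite ler_wpM2r// ler_pM2l//.
  exact: pT (ltnW iT).
pose b3 := \sum_(0 <= i < l) B (p T0) (w (i + T0)%N).
have hb3 : `|b3| <= KB * (KL * T0%:R) * S2.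
  rewrite /b3 (le_trans (ler_norm_sum _ _ _))// /S2 mulr_sumr; apply: ler_sum => i _.
  by apply: (le_trans (HKB _ _)); rewrite ler_wpM2r// ler_pM2l// pT.
have -> : \sum_(0 <= i < l) B (x (T0%:R + i%:R) - x T0%:R) (w (i + T0)%N) = b2 - b3.
  rewrite /b2 /b3 -sumrB; apply: eq_bigr => i _; rewrite -(brBl hB); congr (B _ _).
  by rewrite /p natrD addrC opprB addrA subrK addrC (addrC T0%:R).
have h4 : `|e - (b2 - b3)| <= `|e - (b1 + b2)| + (`|b1| + `|b3|).
  have -> : e - (b2 - b3) = (e - (b1 + b2)) + (b1 + b3).
    by apply/rowP => i; rewrite !mxE; ring.
  by apply: (le_trans (ler_normD _ _)); rewrite lerD2l ler_normD.
have hd : S1 + S2 + `|e - (b1 + b2)| < d / C by [].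
have h5 : C * (S1 + S2 + `|e - (b1 + b2)|) <= d.
  by rewrite mulrC -ler_pdivlMr// ltW.
have e0 : 0 <= `|e - (b1 + b2)| by [].
have KK : 0 <= KB * (KL * T0%:R) by rewrite !mulr_ge0// ltW.
have KK1 := mulr_ge0 KK S10; have KK2 := mulr_ge0 KK S20.
have KK3 := mulr_ge0 KK e0.
move: h5 hb1 hb3; rewrite /C; set c := KB * _ in KK KK1 KK2 KK3 *.
by split; lra.
Qed.

Lemma cheap_vertical (e : 'rV[R]_k) (T0 : nat) :
  (forall d : R, 0 < d -> exists n w, corr_cost B p n w e < d) ->
  forall d : R, 0 < d -> exists l : nat,
    N (x (T0%:R + l%:R) - x T0%:R) (vd T0%:R (T0%:R + l%:R) + e) <= l%:R + d.
Proof.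
move=> He d d0.
have [KB KB0 HKB] := br_bound hB.
have [KP KP0 HKP] := pnorm_bound hN.
have [KV KV0 HKV] := vnorm_bound hN.
(* the first bound makes the quadratic error at most linear in [r]; the other
   two make the horizontal and the vertical costs at most [d / 2] *)
pose r := Num.min 1 (Num.min (d / (4 * KP)) ((d / (2 * KV)) ^+ 2 / (1 + KB))).
have r0 : 0 < r.
  by rewrite !lt_min ltr01 !divr_gt0 ?exprn_gt0 ?divr_gt0 ?mulr_gt0//; lra.
have r1 : r <= 1 by rewrite ge_min lexx.
have r2 : r * (4 * KP) <= d.
  by rewrite -ler_pdivlMr ?mulr_gt0// !ge_min lexx orbT.
have r3 : r * (1 + KB) <= (d / (2 * KV)) ^+ 2.
  by rewrite -ler_pdivlMr ?ltr_pDl// !ge_min lexx !orbT.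
have [l [w [hw he]]] := tail_correction T0 He r0.
exists l; have := insertion hN hgeo T0%:R w l => /=.
set b := \sum_(0 <= i < l) B (_ - _) _ in he *.
set c := \sum_(0 <= i < l) B _ _ => h.
have hc : `|c| <= KB * r.
  pose S := \sum_(0 <= i < l) `|w i|.
  have S0 : 0 <= S by rewrite sumr_ge0.
  have : `|c| <= KB * (S * S).
    rewrite /c big_nat (le_trans (ler_norm_sum _ _ _))//.
    rewrite [X in _ * (_ * X)]big_nat !mulr_sumr; apply: ler_sum => i /andP[_ il].
    apply: (le_trans (HKB _ _)); rewrite -mulrA ler_pM2l// ler_wpM2r//.
    apply: (le_trans (ler_norm_sum _ _ _)).
    rewrite /S (@big_cat_nat _ _ _ i 0 l)//= ?(ltnW il)//.
    by rewrite lerDl sumr_ge0.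
  move=> h2; apply: (le_trans h2); rewrite ler_pM2l//.
  have : S * S <= r * r by rewrite ler_pM.
  by have := ler_wpM2l (ltW r0) r1; lra.
have h1 : \sum_(0 <= i < l) pnorm (w i) <= KP * r.
  apply: (@le_trans _ _ (KP * \sum_(0 <= i < l) `|w i|)); last by rewrite ler_pM2l.
  by rewrite mulr_sumr; apply: ler_sum => i _; exact: HKP.
have h2 := hn_vert hN (x (T0%:R + l%:R) - x T0%:R)
  (vd T0%:R (T0%:R + l%:R) + b + 2^-1 *: c) (e - b - 2^-1 *: c).
have h3 : vnorm (e - b - 2^-1 *: c) <= d / 2.
  apply: (le_trans (HKV _)).
  apply: (@le_trans _ _ (KV * (d / (2 * KV)))); last first.
    by rewrite le_eqVlt; apply/orP; left; apply/eqP; field; rewrite gt_eqF.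
  rewrite ler_pM2l//.
  have dK : 0 <= d / (2 * KV) by rewrite divr_ge0 ?mulr_ge0// ltW.
  rewrite -[leRHS]ger0_norm// -sqrtr_sqr ler_wsqrtr//; apply: le_trans r3.
  apply: (le_trans (ler_normB _ _)); rewrite normrZ ger0_norm ?invr_ge0//.
  by move: hc he; have := mulr_gt0 KB0 r0; lra.
have E : vd T0%:R (T0%:R + l%:R) + b + 2^-1 *: c + (e - b - 2^-1 *: c) =
  vd T0%:R (T0%:R + l%:R) + e by apply/rowP => i; rewrite !mxE; ring.
move: h2; rewrite E => h2; apply: (le_trans h2).
by move: h h1 h3 r2; lra.
Qed.

(** If a curve reached the right point up to a free vertical vector in less time,
    the geodesic could be shortened: the vertical error is repaired after [u],
    at a cost smaller than what was gained. *)
Lemma quotient_minimizing (e : 'rV[R]_k) :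
  (forall d : R, 0 < d -> exists n w, corr_cost B p n w (- e) < d) ->
  forall s u, s <= u -> u - s <= N (x u - x s) (vd s u + e).
Proof.
move=> He s u su; apply/ler_addgt0Pr => d d0.
pose T0 := (Num.truncn u).+1.
have uT : u <= T0%:R by exact/ltW/truncnS_gt.
have [l hl] := cheap_vertical T0 He d0.
pose T : R := T0%:R + l%:R.
have l0 : 0 <= l%:R :> R by [].
have h1 := hn_mul hN (x u - x s) (x T0%:R - x u) (vd s u + e) (vd u T0%:R).
have h2 := hn_mul hN (x u - x s + (x T0%:R - x u)) (x T - x T0%:R)
  (vd s u + e + vd u T0%:R + 2^-1 *: B (x u - x s) (x T0%:R - x u))
  (vd T0%:R T - e).
have h3 := hgeo u T0%:R; have h4 := hgeo s T.
rewrite ger0_norm ?subr_ge0// in h3.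
rewrite ger0_norm in h4; last by rewrite /T; lra.
have E1 : x u - x s + (x T0%:R - x u) + (x T - x T0%:R) = x T - x s.
  by apply/rowP => i; rewrite !mxE; ring.
have E2 : vd s u + e + vd u T0%:R + 2^-1 *: B (x u - x s) (x T0%:R - x u) +
    (vd T0%:R T - e) + 2^-1 *: B (x u - x s + (x T0%:R - x u)) (x T - x T0%:R) =
    vd s T.
  rewrite (vdisp_cat hN x z s T0%:R T) (vdisp_cat hN x z s u T0%:R).
  have -> : x u - x s + (x T0%:R - x u) = x T0%:R - x s by rewrite addrC subrKA.
  by apply/rowP => i; rewrite !mxE; ring.
rewrite E1 E2 h4 in h2; move: h1 h2 h3 hl; rewrite /T; lra.
Qed.

End Calibration.

(** * Asymptotics and straightness of rays *)

Section Rays.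
Context (R : realType) (m k : nat) (B : 'rV[R]_m -> 'rV[R]_m -> 'rV[R]_k).
Context (N : 'rV[R]_m -> 'rV[R]_k -> R).
Hypothesis hN : step2_norm B N.
Let hB := hn_bracket hN.
Local Notation pnorm x := (N x 0).
Local Notation vnorm z := (N 0 z).
Context (x : R -> 'rV[R]_m) (z : R -> 'rV[R]_k).
Local Notation vd := (vdisp B x z).
Hypothesis hgeo : norm_geodesic B N x z.
Context (P : 'M[R]_k).
Hypothesis Pid : forall e : 'rV[R]_k, (e - e *m P) *m P = 0.
Hypothesis Pmin : forall e : 'rV[R]_k, e *m P = 0 ->
  forall s u, s <= u -> u - s <= N (x u - x s) (vd s u + e).
Hypothesis Pbdd : exists2 K, 0 < K & forall (j : nat) y,
  `|B (x j%:R - x 0) y *m P| <= K * `|y|.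

Lemma bracket_bounded : exists2 K, 0 < K & forall s t y, 0 <= s -> 0 <= t ->
  `|B (x t - x s) y *m P| <= K * `|y|.
Proof.
have [K0 K00 HK0] := Pbdd.
have [KB KB0 HKB] := br_bound hB.
have [KL KL0 HKL] := geo_lipschitz hN hgeo.
have [KP KP0 HKP] := mulmx_bound P.
have H t y : 0 <= t -> `|B (x t - x 0) y *m P| <= (K0 + KP * (KB * KL)) * `|y|.
  move=> t0; pose j := Num.truncn t.
  have /andP[jt tj] := truncn_itv t0; rewrite -/j in jt tj.
  have -> : x t - x 0 = (x j%:R - x 0) + (x t - x j%:R) by rewrite [RHS]addrC subrKA.
  rewrite (brDl hB) mulmxDl (le_trans (ler_normD _ _))// mulrDl lerD//.
  apply: (le_trans (HKP _)); rewrite -mulrA ler_pM2l//.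
  apply: (le_trans (HKB _ _)); rewrite ler_wpM2r// ler_pM2l//.
  apply: (le_trans (HKL _ _)); rewrite ger_pMr//.
  rewrite ger0_norm ?subr_ge0// lerBlDr.
  by move: tj; rewrite -addn1 natrD addrC => /ltW.
exists (2 * (K0 + KP * (KB * KL))).
  by rewrite mulr_gt0// addr_gt0// !mulr_gt0.
move=> s t y s0 t0; have -> : x t - x s = (x t - x 0) - (x s - x 0).
  by rewrite opprB subrKA.
rewrite (brBl hB) mulmxBl (le_trans (ler_normB _ _))//.
by move: (H t y t0) (H s y s0); lra.
Qed.

(** Subdivision into unit pieces: the brackets in [vdisp_subdiv] are bounded modulo
    the kernel although the positions are not. *)
Lemma vdisp_linear_growth : exists2 K, 0 < K & forall s (L : nat), 0 <= s ->
  `|vd s (s + L%:R) *m P| <= K * L%:R.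
Proof.
have [K0 K00 HK0] := bracket_bounded.
have [KV KV0 HKV] := vdisp_bound hN hgeo.
have [KL KL0 HKL] := geo_lipschitz hN hgeo.
have [KP KP0 HKP] := mulmx_bound P.
exists (KP * KV + K0 * KL); first by rewrite addr_gt0// mulr_gt0.
move=> s L s0; have := vdisp_subdiv hN x z (fun i => s + i%:R) L.
rewrite addr0 => ->.
have Lsum (c : R) : \sum_(0 <= i < L) c = c * L%:R.
  by rewrite big_const_nat subn0 iter_addr_0 mulr_natr.
have step (i : nat) : s + i.+1%:R - (s + i%:R) = 1 :> R.
  by rewrite -[i.+1]addn1 natrD; ring.
rewrite mulmxDl -scalemxAl !mulmx_suml (le_trans (ler_normD _ _))// mulrDl.
rewrite lerD//.
  apply: (le_trans (ler_norm_sum _ _ _)); rewrite -Lsum; apply: ler_sum => i _.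
  apply: (le_trans (HKP _)); rewrite ler_pM2l//.
  by apply: (le_trans (HKV _ _)); rewrite step expr1n mulr1.
rewrite normrZ ger0_norm ?invr_ge0//.
apply: (@le_trans _ _ (\sum_(0 <= i < L) (K0 * KL))); last by rewrite Lsum.
have half (S : 'rV[R]_k) : 2^-1 * `|S| <= `|S| by have := normr_ge0 S; lra.
apply: (le_trans (half _)).
apply: (le_trans (ler_norm_sum _ _ _)); apply: ler_sum => i _.
apply: (le_trans (HK0 _ _ _ _ _)) => //; first by rewrite addr_ge0.
rewrite ler_pM2l//; apply: (le_trans (HKL _ _)).
by rewrite step normr1 mulr1.
Qed.

(** A straight segment followed by a vertical correction of size at most K L is
    an admissible competitor modulo the kernel, and that correction costs a
    multiple of sqrt L. *)
Lemma chord_defect : exists2 K, 0 < K & forall s (L : nat), 0 <= s ->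
  L%:R <= pnorm (x (s + L%:R) - x s) + K * Num.sqrt L%:R.
Proof.
have [K K0 HK] := vdisp_linear_growth.
have [KV KV0 HKV] := vnorm_bound hN.
exists (KV * Num.sqrt K); first by rewrite mulr_gt0 ?sqrtr_gt0.
move=> s L s0; set u := s + L%:R.
have su : s <= u by rewrite lerDl.
have eP : (- (vd s u - vd s u *m P)) *m P = 0 by rewrite mulNmx Pid oppr0.
have := Pmin eP su.
have -> : vd s u - (vd s u - vd s u *m P) = vd s u *m P by rewrite opprB subrKC.
have := hn_vert hN (x u - x s) 0 (vd s u *m P); rewrite add0r => h1 h2.
have uL : L%:R = u - s by rewrite /u addrC addKr.
rewrite [leLHS]uL.
apply: (le_trans h2); apply: (le_trans h1); rewrite lerD2l.
apply: (le_trans (HKV _)); rewrite -mulrA ler_pM2l// -(sqrtrM _ (ltW K0)).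
by rewrite ler_wsqrtr// HK.
Qed.

(** Otherwise the defects of consecutive pieces would add up linearly, against the
    square root in [chord_defect]. *)
Lemma almost_straight_pieces (l : nat) (d a0 : R) :
  0 < d -> 0 <= a0 -> exists2 a, a0 <= a & l%:R - d <= pnorm (x (a + l%:R) - x a).
Proof.
move=> d0 a00; apply: contrapT => /forallPNP nex.
have lt_d a : a0 <= a -> pnorm (x (a + l%:R) - x a) <= l%:R - d.
  by move=> aa; have /negP := nex a aa; rewrite -ltNge => /ltW.
have [K K0 HK] := chord_defect.
have chain M : pnorm (x (a0 + (M * l)%:R) - x a0) <= M%:R * (l%:R - d).
  elim: M => [|M IH]; first by rewrite mul0n mul0r addr0 subrr (hn0 hN).
  have -> : x (a0 + (M.+1 * l)%:R) - x a0 =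
    (x (a0 + (M * l)%:R + l%:R) - x (a0 + (M * l)%:R)) + (x (a0 + (M * l)%:R) - x a0).
    by rewrite subrKA mulSn natrD addrA addrAC.
  apply: (le_trans (pnormD hN _ _)).
  have := lt_d (a0 + (M * l)%:R); rewrite lerDl ler0n => /(_ isT) h.
  by rewrite -[M.+1]addn1 natrD; move: h IH; lra.
pose M := (Num.truncn (K ^+ 2 * l%:R / d ^+ 2)).+1.
have M0 : 0 < M%:R :> R by rewrite ltr0n.
have hM : K ^+ 2 * l%:R < M%:R * d ^+ 2.
  by rewrite -ltr_pdivrMr ?exprn_gt0// truncnS_gt.
have := HK a0 (M * l)%N a00; have := chain M => h1 h2.
have h3 : M%:R * d <= K * Num.sqrt (M * l)%:R by move: h1 h2; rewrite natrM; lra.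
have : (M%:R * d) ^+ 2 <= (K * Num.sqrt (M * l)%:R) ^+ 2.
  by apply: lerXn2r => //; rewrite nnegrE ?mulr_ge0 ?sqrtr_ge0// ltW.
rewrite !exprMn sqr_sqrtr// natrM.
by move: hM; rewrite -(ltr_pM2l M0); lra.
Qed.

Hypothesis hconv : ~ exists X Y : 'rV[R]_m, X <> Y /\
  forall t : R, 0 <= t <= 1 -> pnorm ((1 - t) *: X + t *: Y) = 1.

(** Two consecutive chords whose sum is almost as long as possible have almost the
    same direction, by uniform convexity, and then so has the whole chord. *)
Lemma initial_chord_direction (r eta a h L d : R) :
  (forall u v, pnorm u <= 1 -> pnorm v <= 1 -> r <= `|u - v| ->
    pnorm (u + v) <= 2 - eta) ->
  0 < h -> 2 * h <= L -> d < h * eta ->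
  L - d <= pnorm (x (a + L) - x a) ->
  `|x (a + h) - x a - (h / L) *: (x (a + L) - x a)| <= h * r.
Proof.
move=> huc h0 hL dh Ld.
have Lh : 0 < L - h by lra.
have L0 : 0 < L by lra.
pose u := h^-1 *: (x (a + h) - x a).
pose w := (L - h)^-1 *: (x (a + L) - x (a + h)).
have u1 : pnorm u <= 1.
  rewrite (pnormZ hN) ger0_norm ?invr_ge0 ?(ltW h0)// ler_pdivrMl// mulr1.
  by apply: (le_trans (pnorm_geo hN hgeo _ _)); rewrite addrC addKr ger0_norm// ltW.
have w1 : pnorm w <= 1.
  rewrite (pnormZ hN) ger0_norm ?invr_ge0 ?(ltW Lh)// ler_pdivrMl// mulr1.
  apply: (le_trans (pnorm_geo hN hgeo _ _)).
  by rewrite (_ : a + L - (a + h) = L - h) ?ger0_norm ?(ltW Lh)//; ring.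
have Eu : x (a + h) - x a = h *: u by rewrite scalerA divff ?gt_eqF// scale1r.
have Ew : x (a + L) - x (a + h) = (L - h) *: w.
  by rewrite scalerA divff ?gt_eqF// scale1r.
have E : x (a + L) - x a = h *: u + (L - h) *: w by rewrite -Eu -Ew [RHS]addrC subrKA.
have uw : `|u - w| < r.
  rewrite ltNge; apply/negP => /(huc u w u1 w1) huw.
  have E2 : x (a + L) - x a = h *: (u + w) + (L - 2 * h) *: w.
    by rewrite E; apply/rowP => i; rewrite !mxE; ring.
  have := pnormD hN (h *: (u + w)) ((L - 2 * h) *: w).
  rewrite -E2 (pnormZ hN h) (pnormZ hN (L - 2 * h)) !ger0_norm ?(ltW h0) ?subr_ge0// => h3.
  have h4 : (L - 2 * h) * pnorm w <= (L - 2 * h) * 1 by rewrite ler_wpM2l// subr_ge0.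
  have h5 : h * pnorm (u + w) <= h * (2 - eta) by rewrite ler_pM2l.
  by move: h3 h4 h5 Ld dh; lra.
rewrite E Eu.
have -> : h *: u - (h / L) *: (h *: u + (L - h) *: w) = (h * ((L - h) / L)) *: (u - w).
  by clearbody u w; apply/rowP => i; rewrite !mxE; field; rewrite gt_eqF.
have c0 : 0 <= h * ((L - h) / L) by rewrite mulr_ge0 ?divr_ge0 ?ltW.
rewrite normrZ (ger0_norm c0) -mulrA ler_pM2l//.
apply: le_trans (ltW uw); rewrite ler_piMl// ler_pdivrMr// mul1r; lra.
Qed.

(** [v] is an accumulation point of the directions of almost straight pieces of
    growing length.  It is central modulo the kernel because the bracket with a
    chord of length about L is bounded, so that dividing by L gives 0 in the
    limit.  The bound is uniform over [h0 <= h' <= h] since all these subpieces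
    are controlled by the same chord. *)
Lemma asymptotic_direction : exists v : 'rV[R]_m,
  [/\ pnorm v <= 1, forall y, B v y *m P = 0 &
    forall h0 h e T, 0 < h0 -> h0 <= h -> 0 < e ->
      exists2 a, T <= a & 0 <= a /\ forall h', h0 <= h' <= h ->
        `|x (a + h') - x a - h' *: v| <= e].
Proof.
have [a Ha] : {a : nat -> R & forall i, i%:R <= a i /\
    i.+1%:R - i.+1%:R^-1 <= pnorm (x (a i + i.+1%:R) - x (a i))}.
  apply: (@choice _ _ (fun (i : nat) (c : R) => i%:R <= c /\
    i.+1%:R - i.+1%:R^-1 <= pnorm (x (c + i.+1%:R) - x c))) => i.
  have ip : 0 < i.+1%:R^-1 :> R by rewrite invr_gt0.
  by have [c ic hc] := almost_straight_pieces i.+1 ip (ler0n _ i); exists c.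
have [KL KL0 HKL] := geo_lipschitz hN hgeo.
have [KB KB0 HKB] := br_bound hB.
have [KM KM0 HKM] := mulmx_bound P.
have [KP KP0 HKP] := pnorm_bound hN.
have [K K0 HK] := bracket_bounded.
pose v_ i := i.+1%:R^-1 *: (x (a i + i.+1%:R) - x (a i)).
have sz i : a i + i.+1%:R - a i = i.+1%:R by rewrite addrC addKr.
have v_le i : `|v_ i| <= KL.
  rewrite normrZ ger0_norm ?invr_ge0// ler_pdivrMl//.
  by apply: (le_trans (HKL _ _)); rewrite sz mulrC normr_nat.
have v_pn i : pnorm (v_ i) <= 1.
  rewrite (pnormZ hN) ger0_norm ?invr_ge0// ler_pdivrMl//.
  by apply: (le_trans (pnorm_geo hN hgeo _ _)); rewrite sz mulr1 normr_nat.
have [v Hv] := bounded_seq_cluster v_le.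
exists v; split.
- apply/ler_addgt0Pr => e e0.
  have [i _ hi] := Hv (e / KP) 0%N (divr_gt0 e0 KP0).
  have := pnormD hN (v_ i) (v - v_ i); rewrite subrKC => h1.
  apply: (le_trans h1); rewrite lerD//; apply: (le_trans (HKP _)).
  by rewrite -ler_pdivlMl// distrC mulrC ltW.
- move=> y; apply/eqP; rewrite -normr_le0; apply/ler_addgt0Pr => e e0; rewrite add0r.
  pose C := 1 + (KM * KB + K) * `|y|.
  have C0 : 0 < C by rewrite ltr_pwDl// mulr_ge0// addr_ge0 ?mulr_ge0// ltW.
  have [i ji hi] := Hv (e / C) (Num.truncn (e / C)^-1) (divr_gt0 e0 C0).
  have i0 : 0 < i.+1%:R :> R by [].
  have hi' : i.+1%:R^-1 <= e / C.
    rewrite -[leRHS]invrK lef_pV2 ?posrE ?invr_gt0 ?divr_gt0//.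
    by apply/ltW/(lt_le_trans (truncnS_gt _)); rewrite ler_nat ltnS.
  have h1 : `|B (v - v_ i) y *m P| <= KM * (KB * (e / C * `|y|)).
    apply: (le_trans (HKM _)); rewrite ler_pM2l//.
    apply: (le_trans (HKB _ _)); rewrite -mulrA ler_pM2l// ler_wpM2r// distrC.
    exact: ltW.
  have h2 : `|B (v_ i) y *m P| <= e / C * (K * `|y|).
    rewrite /v_ (brZl hB) -scalemxAl normrZ ger0_norm ?invr_ge0//.
    apply: ler_pM => //; apply: HK.
      by apply: le_trans (proj1 (Ha i)).
    by rewrite addr_ge0//; apply: le_trans (proj1 (Ha i)).
  have -> : B v y *m P = B (v - v_ i) y *m P + B (v_ i) y *m P.
    by rewrite -mulmxDl -(brDl hB) subrK.
  apply: (le_trans (ler_normD _ _)); apply: (le_trans (lerD h1 h2)).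
  have -> : KM * (KB * (e / C * `|y|)) + e / C * (K * `|y|) = e / C * (C - 1).
    by rewrite /C; ring.
  by rewrite mulrAC ler_pdivrMr// ler_pM2l// gerBl.
- move=> h0 h e T h00 h0h e0.
  have hp : 0 < h by exact: lt_le_trans h0h.
  have r0 : 0 < e / (2 * h) by rewrite divr_gt0// mulr_gt0.
  have [eta eta0 huc] := uniform_convexity hN hconv r0.
  pose M := 1 + `|T| + 2 * h + (h0 * eta)^-1.
  have he0 : 0 < h0 * eta by rewrite mulr_gt0.
  have hV : 0 < (h0 * eta)^-1 by rewrite invr_gt0.
  have T0 : 0 <= `|T| by [].
  have [i ji hi] := Hv (e / (2 * h)) (Num.truncn M).+1 r0.
  have Mi : M < i%:R by apply: (lt_le_trans (truncnS_gt _)); rewrite ler_nat.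
  have iS : i.+1%:R = i%:R + 1 :> R by rewrite -natr1.
  have [ia hia] := Ha i.
  exists (a i); first by move: (ler_norm T) Mi; rewrite /M; lra.
  split; first by apply: le_trans ia.
  move=> h' /andP[h0h' h'h]; have h'0 : 0 < h' by exact: lt_le_trans h0h'.
  have h1 := @initial_chord_direction _ _ _ h' _ _ huc h'0 _ _ hia.
  have h2 : `|x (a i + h') - x (a i) -
      (h' / i.+1%:R) *: (x (a i + i.+1%:R) - x (a i))| <= h' * (e / (2 * h)).
    apply: h1; first by move: Mi; rewrite iS /M; lra.
    apply: (@lt_le_trans _ _ (h0 * eta)); last by rewrite ler_pM2r.
    rewrite -[ltRHS]invrK ltf_pV2 ?posrE ?invr_gt0//.
    by move: Mi; rewrite iS /M; lra.
  have -> : x (a i + h') - x (a i) - h' *: v = (x (a i + h') - x (a i) -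
      (h' / i.+1%:R) *: (x (a i + i.+1%:R) - x (a i))) + h' *: (v_ i - v).
    by rewrite (scalerBr h') (scalerA h') addrA subrK.
  apply: (le_trans (ler_normD _ _)); rewrite normrZ (ger0_norm (ltW h'0)).
  have h3 : h' * `|v_ i - v| <= h' * (e / (2 * h)) by rewrite ler_pM2l// ltW.
  apply: (le_trans (lerD h2 h3)).
  have h4 : h' * (e / (2 * h)) <= h * (e / (2 * h)) by rewrite ler_pM2r.
  have h5 : h * (e / (2 * h)) = e / 2 by field; rewrite gt_eqF.
  by move: h4; rewrite h5; lra.
Qed.

Lemma polygon_norm n (y : nat -> 'rV[R]_m) :
  N (\sum_(0 <= i < n) y i)
    (2^-1 *: \sum_(0 <= i < n) B (\sum_(0 <= j < i) y j) (y i)) <=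
  \sum_(0 <= i < n) pnorm (y i).
Proof.
elim: n => [|n IH]; first by rewrite !big_geq// scaler0 (hn0 hN).
rewrite !big_nat_recr//= scalerDr.
have := hn_mul hN (\sum_(0 <= i < n) y i) (y n)
  (2^-1 *: \sum_(0 <= i < n) B (\sum_(0 <= j < i) y j) (y i)) 0.
by rewrite addr0 => /le_trans; apply; rewrite lerD2r.
Qed.

(** The gap [2 - pnorm (a + v)] is bounded below by an affine function of the
    distance from [a] to [v]; this lower bound can be averaged. *)
Lemma average_convexity_gap (v : 'rV[R]_m) (r : R) : pnorm v <= 1 -> 0 < r ->
  exists2 g, 0 < g & forall n (a : nat -> 'rV[R]_m),
    (forall i, pnorm (a i) <= 1) ->
    n%:R * r <= `|\sum_(0 <= i < n) a i - n%:R *: v| ->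
    \sum_(0 <= i < n) pnorm (a i + v) <= n%:R * (2 - g).
Proof.
move=> v1 r0; have r20 : 0 < r / 2 by rewrite divr_gt0.
(* beyond [r / 2] the gap is [eta], and [`|u - v|] is at most [2 * K]: a line of
   slope [c] through [r / 2] stays below the gap *)
have [eta eta0 huc] := uniform_convexity hN hconv r20.
have [K K0 HK] := pnorm_lower hN.
have c0 : 0 < eta / (2 * K) by rewrite divr_gt0// mulr_gt0.
pose c := eta / (2 * K).
have cK : c * (2 * K) = eta by rewrite divfK// mulf_neq0// gt_eqF.
have gap u : pnorm u <= 1 -> pnorm (u + v) <= 2 - c * (`|u - v| - r / 2).
  move=> u1; have uv : `|u - v| <= 2 * K.
    apply: (le_trans (ler_normB _ _)).
    have := HK u; have := HK v; have := ler_wpM2l (ltW K0) u1.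
    by have := ler_wpM2l (ltW K0) v1; lra.
  have [uvr|uvr] := leP (r / 2) `|u - v|.
    apply: (le_trans (huc _ _ u1 v1 uvr)); rewrite lerD2l lerN2 -cK ler_pM2l//.
    by lra.
  have h1 := pnormD hN u v.
  have : c * (`|u - v| - r / 2) <= 0 by rewrite pmulr_rle0// subr_le0 ltW.
  by lra.
exists (c * (r / 2)); first by rewrite mulr_gt0.
move=> n a a1 hr.
apply: (@le_trans _ _ (\sum_(0 <= i < n) (2 - c * (`|a i - v| - r / 2)))).
  by apply: ler_sum => i _; exact: gap.
have Lsum (d : R) : \sum_(0 <= i < n) d = n%:R * d.
  by rewrite big_const_nat subn0 iter_addr_0 mulr_natl.
rewrite sumrB Lsum -mulr_sumr sumrB Lsum.
have : n%:R * r <= \sum_(0 <= i < n) `|a i - v|.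
  apply: (le_trans hr); apply: le_trans (ler_norm_sum _ _ _).
  by rewrite sumrB big_const_nat subn0 iter_addr_0 scaler_nat.
by rewrite -(ler_pM2l c0) -/c; lra.
Qed.

(** The spreading argument.  If [x (s + h) - x s] differs from [h *: v], then an
    almost straight piece [a, a + h] is deleted and its displacement, nearly
    [h *: v], is distributed evenly along [s, s + h].  The total time drops from
    [2 * h] by a fixed amount, while the horizontal and vertical errors modulo the
    kernel of [P] tend to 0 with the mesh [de], against [Pmin]. *)
Lemma ray_projection_line : exists v : 'rV[R]_m,
  forall s h, 0 <= s -> 0 < h -> x (s + h) - x s = h *: v.
Proof.
have [v [v1 vB vdir]] := asymptotic_direction.
exists v => s h s0 hp; apply/eqP; rewrite -subr_eq0 -normr_eq0; apply/negPn/negP => D0.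
have {}D0 : 0 < `|x (s + h) - x s - h *: v| by rewrite lt0r D0 normr_ge0.
set D := `|_| in D0.
have [g g0 Hg] := average_convexity_gap v1 (divr_gt0 D0 hp).
have [KV KV0 HKV] := vdisp_bound hN hgeo.
have [KB KB0 HKB] := br_bound hB.
have [KM KM0 HKM] := mulmx_bound P.
have [KP KP0 HKP] := pnorm_bound hN.
have [KW KW0 HKW] := vnorm_bound hN.
pose C := 2 * KM * KV + KM * KB.
have C0 : 0 < C by rewrite addr_gt0// !mulr_gt0.
pose j := (Num.truncn ((KP + KW * Num.sqrt C) / g)).+1.
(* a square number of pieces makes the square root in [vnorm_bound] explicit:
   both errors below are of order [h / j], against a gain of [h * g] *)
pose n := (j ^ 2)%N.
have j0 : 0 < j%:R :> R by [].
have j1 : 1 <= j%:R :> R by rewrite ler1n.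
have nE : n%:R = j%:R ^+ 2 :> R by rewrite natrX.
have n0 : 0 < n%:R :> R by rewrite nE exprn_gt0.
have hj : (KP + KW * Num.sqrt C) < j%:R * g.
  by rewrite -ltr_pdivrMr// truncnS_gt.
pose de := h / n%:R.
have de0 : 0 < de by rewrite divr_gt0.
have nde : n%:R * de = h by rewrite /de mulrC divfK// gt_eqF.
have deh : de <= h by rewrite ler_pdivrMr// ler_peMr ?(ltW hp)// nE exprn_ege1.
have [a sha [a0 ha]] := vdir de h de (s + h) de0 deh de0.
(* vertical vectors are compared modulo the kernel of [P], where brackets with
   [v] vanish; only the linearity of [pi] matters *)
have [pi Epi] : exists pi : 'rV[R]_k -> 'rV[R]_k, forall e, e *m P = pi e.
  by exists (mulmx^~ P).
have piD u w : pi (u + w) = pi u + pi w by rewrite -!Epi mulmxDl.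
have piZ c u : pi (c *: u) = c *: pi u by rewrite -!Epi scalemxAl.
have piN u : pi (- u) = - pi u by rewrite -!Epi mulNmx.
have pi0 : pi 0 = 0 by rewrite -Epi mul0mx.
have pi_sum (F : nat -> 'rV[R]_k) l :
    pi (\sum_(0 <= i < l) F i) = \sum_(0 <= i < l) pi (F i).
  by rewrite -Epi mulmx_suml; apply: eq_bigr => i _; rewrite Epi.
have vBp y : pi (B v y) = 0 by rewrite -Epi.
have Bvp y : pi (B y v) = 0 by rewrite (br_anti hB) piN vBp oppr0.
have brE := (brDl hB, brDr hB, brNl hB, brNr hB, brZl hB, brZr hB).
have piE := (piD, piN, piZ, vBp, Bvp).
pose subd (c : R) (i : nat) := c + i%:R * de.
have subd0 c : subd c 0 = c by rewrite /subd mul0r addr0.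
have subdn c : subd c n = c + h by rewrite /subd nde.
have subdS c i : subd c i.+1 - subd c i = de.
  by rewrite /subd -[i.+1]addn1 natrD; ring.
have vd_sum c : `|pi (\sum_(0 <= i < n) vd (subd c i) (subd c i.+1))| <=
    KM * KV * (h * de).
  rewrite -Epi; apply: (le_trans (HKM _)); rewrite -mulrA ler_pM2l//.
  apply: (le_trans (ler_norm_sum _ _ _)).
  apply: (@le_trans _ _ (\sum_(0 <= i < n) KV * de ^+ 2)).
    by apply: ler_sum => i _; apply: (le_trans (HKV _ _)); rewrite subdS.
  by rewrite big_const_nat subn0 iter_addr_0 -mulr_natl -nde; lra.
have vd_pi c : pi (vd c (c + h)) =
    pi (\sum_(0 <= i < n) vd (subd c i) (subd c i.+1)) +
    2^-1 *: \sum_(0 <= i < n)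
      pi (B (x (subd c i) - x c) (x (subd c i.+1) - x (subd c i))).
  by rewrite -subdn -{1 3}(subd0 c) (vdisp_subdiv hN) piD piZ !pi_sum !subd0.
(* the polygon with sides [xi i + de *: v] spreads [h *: v] over [s, s + h] *)
pose xi i := x (subd s i.+1) - x (subd s i).
pose y i := xi i + de *: v.
have Ey i : \sum_(0 <= l < i) y l = x (subd s i) - x s + (i%:R * de) *: v.
  elim: i => [|i IH]; first by rewrite big_geq// subd0 subrr mul0r scale0r addr0.
  rewrite big_nat_recr//= IH /y /xi -natr1 mulrDl mul1r scalerDl.
  by apply/rowP => l; rewrite !mxE; ring.
pose Z1 := 2^-1 *: \sum_(0 <= i < n) B (\sum_(0 <= l < i) y l) (y i).
have hZ1 := polygon_norm n y; rewrite -/Z1 Ey subdn nde in hZ1.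
have piZ1 : pi Z1 = pi (vd s (s + h)) -
    pi (\sum_(0 <= i < n) vd (subd s i) (subd s i.+1)).
  rewrite vd_pi [in RHS]addrC addKr /Z1 piZ pi_sum; congr (_ *: _).
  apply: eq_bigr => i _; rewrite Ey /y -/(xi i); move: (xi i) (x (subd s i) - x s) => p q.
  by rewrite !brE !piE !scaler0 !addr0.
have cost_y : \sum_(0 <= i < n) pnorm (y i) <= h * (2 - g).
  have Exi i : xi i = de *: (de^-1 *: xi i) by rewrite scalerA divff ?gt_eqF// scale1r.
  have -> : \sum_(0 <= i < n) pnorm (y i) =
      de * \sum_(0 <= i < n) pnorm (de^-1 *: xi i + v).
    rewrite mulr_sumr; apply: eq_bigr => i _.
    by rewrite /y {1}Exi -scalerDr (pnormZ hN) ger0_norm ?(ltW de0).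
  have : \sum_(0 <= i < n) pnorm (de^-1 *: xi i + v) <= n%:R * (2 - g).
    apply: Hg => [i|].
      rewrite (pnormZ hN) ger0_norm ?invr_ge0 ?(ltW de0)// ler_pdivrMl// mulr1.
      by apply: (le_trans (pnorm_geo hN hgeo _ _)); rewrite subdS ger0_norm// ltW.
    have -> : \sum_(0 <= i < n) de^-1 *: xi i - n%:R *: v =
        de^-1 *: (x (s + h) - x s - h *: v).
      rewrite -scaler_sumr (telescope_sumr (fun i => x (subd s i)))//.
      rewrite subdn subd0 [in RHS]scalerBr scalerA -nde; congr (_ - _ *: v).
      by field; rewrite gt_eqF.
    rewrite normrZ ger0_norm ?invr_ge0 ?(ltW de0)// -/D /de invf_div.
    by rewrite le_eqVlt; apply/orP; left; apply/eqP; field; rewrite gt_eqF.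
  by rewrite -(ler_pM2l de0) mulrA (mulrC de n%:R) nde.
(* the vertical part of the removed piece is small modulo the kernel: its
   brackets with [v] vanish there, so only the deviations [ep i] count *)
pose al := x (a + h) - x a.
have hal : `|al - h *: v| <= de by apply: ha; rewrite deh lexx.
pose ep i := x (subd a i) - x a - (i%:R * de) *: v.
have hep i : (i <= n)%N -> `|ep i| <= de.
  case: i => [|i] i_n.
    by rewrite /ep subd0 subrr mul0r scale0r subr0 normr0 ltW.
  apply: ha; rewrite -[X in X <= _ <= _]mul1r -nde !ler_pM2r// ler1n ler_nat.
  by rewrite i_n.
have piva : `|pi (vd a (a + h))| <= KM * KV * (h * de) + KM * KB * (h * de).
  rewrite vd_pi (le_trans (ler_normD _ _))// lerD//.
  rewrite normrZ ger0_norm ?invr_ge0// ler_pdivrMl//.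
  apply: (le_trans (ler_norm_sum _ _ _)).
  apply: (@le_trans _ _ (\sum_(0 <= i < n) 2 * (KM * KB * de ^+ 2))); last first.
    by rewrite big_const_nat subn0 iter_addr_0 -mulr_natl -nde; lra.
  rewrite big_nat [leRHS]big_nat; apply: ler_sum => i /andP[_ i_n].
  have -> : pi (B (x (subd a i) - x a) (x (subd a i.+1) - x (subd a i))) =
      pi (B (ep i) (ep i.+1 - ep i)).
    have -> : x (subd a i.+1) - x (subd a i) = ep i.+1 - ep i + de *: v.
      by rewrite /ep -natr1 mulrDl mul1r scalerDl; apply/rowP => l; rewrite !mxE; ring.
    have -> : x (subd a i) - x a = ep i + (i%:R * de) *: v by rewrite subrK.
    move: (ep i.+1) (ep i) => p q.
    by rewrite !brE !piE !(scaler0, subrr, addr0).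
  rewrite -Epi; apply: (le_trans (HKM _)).
  rewrite -!mulrA mulrCA ler_pM2l//; apply: (le_trans (HKB _ _)).
  rewrite -mulrA [leRHS]mulrCA ler_pM2l//.
  have h1 := hep i (ltnW i_n); have h2 := hep i.+1 i_n.
  have : `|ep i.+1 - ep i| <= 2 * de by apply: (le_trans (ler_normB _ _)); lra.
  by move=> h3; rewrite expr2 mulrCA; apply: ler_pM.
(* the competitor [Z3]: the polygon, the untouched piece [s + h, a], and the
   short segment [al - h *: v] that restores the horizontal endpoint *)
pose be := x a - x (s + h).
pose Z2 := Z1 + vd (s + h) a + 2^-1 *: B (x (s + h) - x s + h *: v) be.
have hZ2 := hn_mul hN (x (s + h) - x s + h *: v) be Z1 (vd (s + h) a).
rewrite -/Z2 hgeo ger0_norm ?subr_ge0// in hZ2.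
pose Z3 := Z2 + 0 + 2^-1 *: B (x (s + h) - x s + h *: v + be) (al - h *: v).
have hZ3 := hn_mul hN (x (s + h) - x s + h *: v + be) (al - h *: v) Z2 0.
have EX : x (s + h) - x s + h *: v + be + (al - h *: v) = x (a + h) - x s.
  by rewrite /be /al; apply/rowP => l; rewrite !mxE; ring.
rewrite -/Z3 EX in hZ3.
pose f := pi (Z3 - vd s (a + h)).
have Ef : f = - pi (\sum_(0 <= i < n) vd (subd s i) (subd s i.+1))
    - pi (vd a (a + h)).
  rewrite /f (vdisp_cat hN x z s a) (vdisp_cat hN x z s (s + h)) -/be -/al.
  have -> : x a - x s = x (s + h) - x s + be by rewrite /be [RHS]addrC subrKA.
  rewrite /Z3 /Z2; move: (x (s + h) - x s) => X; clearbody Z1 be al.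
  rewrite !brE !piE piZ1 !piE pi0.
  move: (pi (B X be)) (pi (B X al)) (pi (B be al)) => b1 b2 b3.
  by apply/rowP => l; rewrite !mxE; ring.
have hf : `|f| <= C * (h * de).
  rewrite Ef (le_trans (ler_normB _ _))// normrN.
  by move: (vd_sum s) piva; rewrite /C; lra.
have eP : (Z3 - vd s (a + h) - f) *m P = 0 by rewrite /f -Epi Pid.
have sah : s <= a + h by lra.
have hmin := Pmin eP sah.
have E : vd s (a + h) + (Z3 - vd s (a + h) - f) = Z3 - f.
  by rewrite addrA subrKC.
rewrite E in hmin.
have h1 := hn_vert hN (x (a + h) - x s) Z3 (- f); rewrite (vnormN hN) in h1.
have h2 : vnorm f <= KW * (Num.sqrt C * (h / j%:R)).
  apply: (le_trans (HKW _)); rewrite ler_pM2l//.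
  have hj0 : 0 <= h / j%:R by rewrite divr_ge0// ltW.
  rewrite -[h / _](ger0_norm hj0) -sqrtr_sqr -(sqrtrM _ (ltW C0)) ler_wsqrtr//.
  apply: (le_trans hf); rewrite ler_pM2l// /de nE expr_div_n.
  by rewrite expr2 mulrA.
have h3 : pnorm (al - h *: v) <= KP * (h / j%:R).
  apply: (le_trans (HKP _)); rewrite ler_pM2l//; apply: (le_trans hal).
  rewrite /de ler_pM2l// lef_pV2 ?posrE// nE expr2 ler_peMr// ltW.
have h4 : (KP + KW * Num.sqrt C) * (h / j%:R) < h * g.
  have hj0 : 0 < h / j%:R by rewrite divr_gt0.
  have -> : h * g = j%:R * g * (h / j%:R) by field; rewrite gt_eqF.
  by rewrite ltr_pM2r.
by move: hmin h1 h2 h3 h4 hZ1 hZ2 hZ3 cost_y; lra.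
Qed.

(** The quadratic bound of [vdisp_bound], summed over n pieces, is of order 1/n,
    and the brackets of [vdisp_subdiv] vanish along a line. *)
Lemma ray_straight : exists v : 'rV[R]_m, forall t, 0 <= t ->
  x t - x 0 = t *: v /\ vd 0 t = 0.
Proof.
have [v Hv] := ray_projection_line; exists v.
have line s t : 0 <= s -> s <= t -> x t - x s = (t - s) *: v.
  rewrite [s <= t]le_eqVlt => s0 /predU1P[->|st]; first by rewrite !subrr scale0r.
  by have := Hv s (t - s) s0; rewrite subr_gt0 st subrKC => ->.
move=> t t0; split; first by rewrite line// subr0.
have [KV KV0 HKV] := vdisp_bound hN hgeo.
apply/eqP; rewrite -normr_le0; apply/ler_addgt0Pr => e e0; rewrite add0r.
pose n := (Num.truncn (KV * t ^+ 2 / e)).+1.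
have n0 : 0 < n%:R :> R by [].
have hn : KV * t ^+ 2 < n%:R * e by rewrite -ltr_pdivrMr// truncnS_gt.
have := vdisp_subdiv hN x z (fun i => i%:R * (t / n%:R)) n.
rewrite mul0r mulrC divfK ?gt_eqF// => ->.
have tn : 0 <= t / n%:R by rewrite divr_ge0.
have tS i : i.+1%:R * (t / n%:R) - i%:R * (t / n%:R) = t / n%:R.
  by rewrite -natr1; ring.
rewrite [X in _ + 2^-1 *: X]big1 ?scaler0 ?addr0; last first.
  move=> i _; rewrite !line ?mulr_ge0// ?ler_wpM2r ?ler_nat//.
  by rewrite (brZl hB) (brZr hB) (br_alt hB) !scaler0.
apply: (le_trans (ler_norm_sum _ _ _)).
apply: (@le_trans _ _ (\sum_(0 <= i < n) KV * (t / n%:R) ^+ 2)).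
  by apply: ler_sum => i _; apply: (le_trans (HKV _ _)); rewrite tS.
have -> : \sum_(0 <= i < n) KV * (t / n%:R) ^+ 2 = KV * t ^+ 2 / n%:R.
  rewrite big_const_nat subn0 iter_addr_0 -[_ *+ n]mulr_natl.
  by field; rewrite gt_eqF.
by rewrite ler_pdivrMr// [leRHS]mulrC ltW.
Qed.

End Rays.

(** * Infinite geodesics of a homogeneous norm are lines *)

(** The results on rays apply from every starting time, so the line extends to all
    times. *)
Theorem norm_geodesic_line (R : realType) (m k : nat)
    (B : 'rV[R]_m -> 'rV[R]_m -> 'rV[R]_k) (N : 'rV[R]_m -> 'rV[R]_k -> R)
    (x : R -> 'rV[R]_m) (z : R -> 'rV[R]_k) :
  step2_norm B N ->
  (~ exists X Y : 'rV[R]_m, X <> Y /\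
    forall t : R, 0 <= t <= 1 -> N ((1 - t) *: X + t *: Y) 0 = 1) ->
  norm_geodesic B N x z ->
  exists v, forall t, x t = x 0 + t *: v /\
    z t = z 0 + 2^-1 *: B (x 0) (t *: v).
Proof.
move=> hN hconv hgeo; have hB := hn_bracket hN.
have ray (S : R) : exists v : 'rV[R]_m, forall t, - S <= t ->
    x t - x (- S) = (t + S) *: v /\ vdisp B x z (- S) t = 0.
  pose xS t := x (t - S); pose zS t := z (t - S).
  have hgeoS : norm_geodesic B N xS zS.
    by move=> s t; rewrite hgeo; congr (Num.norm _); ring.
  have [P [P1 P2 P3]] := corr_projection hB (fun j => xS j%:R - xS 0).
  have Pmin (e : 'rV[R]_k) : e *m P = 0 -> forall s u, s <= u ->
      u - s <= N (xS u - xS s) (vdisp B xS zS s u + e).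
    move=> eP; apply: (quotient_minimizing hN hgeoS) => d d0.
    by apply: P2; rewrite // mulNmx eP oppr0.
  have [v Hv] := ray_straight hN hgeoS P1 Pmin P3 hconv.
  exists v => t St; have := Hv (t + S); rewrite -[0 <= _]/(0 <= _) -lerBlDr sub0r.
  by move=> /(_ St); rewrite /vdisp /xS /zS addrK sub0r.
(* the direction found from the starting time [- S] does not depend on [S] *)
exists (x 1 - x 0) => t.
have [v Hv] := ray (`|t| + 1); set S := `|t| + 1 in Hv.
have tS : - S <= t by rewrite /S; have := ler_norm (- t); rewrite normrN; lra.
have S0 : 0 < S by rewrite /S; have := normr_ge0 t; lra.
have [|h0 h0'] := Hv 0; first by lra.
have [|h1 _] := Hv 1; first by lra.
have [|ht ht'] := Hv t; first by [].
have Ev : x 1 - x 0 = v.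
  have -> : x 1 - x 0 = (x 1 - x (- S)) - (x 0 - x (- S)) by rewrite opprB subrKA.
  by rewrite h1 h0 add0r scalerDl scale1r addrK.
have Et : x t - x 0 = t *: v.
  have -> : x t - x 0 = (x t - x (- S)) - (x 0 - x (- S)) by rewrite opprB subrKA.
  by rewrite ht h0 add0r scalerDl addrK.
have Ex : x t = x 0 + t *: v by rewrite -Et subrKC.
rewrite Ev; split => //.
have := vdisp_cat hN x z (- S) 0 t.
rewrite ht' h0' h0 Et !add0r (brZl hB) (brZr hB) (br_alt hB) !scaler0 addr0.
rewrite /vdisp Ex (brDr hB) (br_alt hB) add0r => /esym/eqP.
by rewrite subr_eq add0r subr_eq addrC => /eqP.
Qed.

(** * Differential calculus *)

Lemma near_eq_diff (R : realType) (V W : normedModType R) (f g : V -> W) (x : V) :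
  (\near x, f x = g x) -> differentiable f x ->
  differentiable g x /\ 'd g x = 'd f x :> (V -> W).
Proof.
move=> fg df; have fgx : f x = g x by exact: nbhs_singleton fg.
have [cf ef] := proj1 (diff_locallyP _ _) df.
have eg : g \o shift x = cst (g x) + 'd f x +o_ 0 id.
  apply/eqaddoP => e e0; have /eqaddoP/(_ e e0) := ef.
  rewrite (near_shift 0 x) subr0 in fg.
  by apply: filterS2 fg => h /= /[!fctE] /= <-; rewrite fgx.
have Ed : 'd g x = 'd f x :> (V -> W) by exact: diff_unique.
by split; [apply/diff_locallyP; rewrite Ed; exact: conj cf eg|exact: Ed].
Qed.

Lemma diff_bound (R : realType) (V W : normedModType R) (f : V -> W) (x : V) :
  differentiable f x -> forall e : R, 0 < e ->
  \forall h \near (0 : V), `|f (h + x) - f x - 'd f x h| <= e * `|h|.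
Proof.
move=> /diff_locallyP[_ /eqaddoP ef] e e0.
apply: filterS (ef e e0) => h /=.
by rewrite !fctE /= opprD addrA.
Qed.

Lemma near_diff_comp (R : realType) (U V W : normedModType R) (f : U -> V)
    (g : V -> W) (k : U -> W) (x : U) :
  differentiable f x -> differentiable g (f x) ->
  (\forall y \near x, g (f y) = k y) ->
  differentiable k x /\ forall Y, 'd k x Y = 'd g (f x) ('d f x Y).
Proof.
move=> df dg E; have [dk Ek] := near_eq_diff E (differentiable_comp df dg).
by split => // Y; rewrite Ek (diff_comp df dg).
Qed.

Lemma is_derive_comp_diff (R : realType) (V W : normedModType R) (f : R -> V)
    (F : V -> W) (t : R) (X : V) :
  is_derive t 1 f X -> differentiable F (f t) ->
  is_derive t 1 (F \o f) ('d F (f t) X).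
Proof.
move=> [df <-] dF; have dft := proj1 (derivable1_diffP _ _) df.
have dc := differentiable_comp dft dF.
apply: DeriveDef; first exact: (proj2 (derivable1_diffP _ _) dc).
by rewrite (deriveE _ dc) (diff_comp dft dF) (deriveE _ dft).
Qed.

Lemma is_derive_pair (R : realType) (V W : normedModType R) (f : R -> V)
    (g : R -> W) (t : R) (X : V) (Y : W) :
  is_derive t 1 f X -> is_derive t 1 g Y ->
  is_derive t 1 (fun t => (f t, g t)) (X, Y).
Proof.
move=> [df <-] [dg <-].
have Df := proj1 (derivable1_diffP _ _) df.
have Dg := proj1 (derivable1_diffP _ _) dg.
have Dp := differentiable_pair Df Dg.
apply: DeriveDef; first exact: (proj2 (derivable1_diffP _ _) Dp).
by rewrite (deriveE _ Dp) (diff_pair Df Dg) (deriveE _ Df) (deriveE _ Dg).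
Qed.

Lemma is_derive_cvg (R : realType) (V : normedModType R) (f : R -> V) (t : R) X :
  is_derive t 1 f X -> f @ t --> f t.
Proof.
by move=> [df _]; exact: differentiable_continuous (proj1 (derivable1_diffP _ _) df).
Qed.

Lemma is_derive_inj (R : realType) (V : normedModType R) (f : R -> V) (t : R) X Y :
  is_derive t 1 f X -> is_derive t 1 f Y -> X = Y.
Proof. by move=> [_ <-] [_ <-]. Qed.

Lemma is_derive_at_shift (R : realType) (V : normedModType R) (F : R -> V) (t : R) X :
  is_derive (0 : R) 1 (fun e => F (e + t)) X -> is_derive t 1 F X.
Proof.
have E : (fun h : R => h^-1 *: (((fun e => F (e + t)) \o shift 0) (h *: 1) - F (0 + t)))
    = (fun h : R => h^-1 *: ((F \o shift t) (h *: 1) - F t)).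
  by apply/funext => h /=; rewrite addr0 add0r.
by move=> [dF <-]; split; rewrite /derivable /derive -E.
Qed.

Lemma derive0_cst (R : realType) n (F : R -> 'rV[R]_n) (d : R) :
  (forall s : R, `|s| < d -> is_derive s 1 F 0) ->
  forall t : R, `|t| < d -> F t = F 0.
Proof.
move=> dF t td; apply/rowP => i.
pose f (s : R) : R := F s ord0 i.
have df (s : R) : `|s| < d -> is_derive s 1 f 0.
  move=> sd; have [d1 e1] := dF s sd; split; first exact: (proj1 (derivable_mxP _ _ _) d1).
  by move: e1; rewrite derive_mx// => /rowP/(_ i); rewrite !mxE.
have fcst a b : a <= b -> `|a| < d -> `|b| < d -> f a = f b.
  rewrite le_eqVlt => /predU1P[->//|ab] ad bd.
  have [s| |s sab] := @MVT _ f (fun=> 0) a b ab.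
  - rewrite in_itv /= => /andP[as_ sb]; apply: df.
    by move: ad bd; rewrite !ltr_norml => /andP[? ?] /andP[? ?]; apply/andP; split; lra.
  - apply: derivable_within_continuous => s; rewrite in_itv /= => /andP[as_ sb].
    apply: (@ex_derive _ _ _ _ _ _ 0); apply: df.
    by move: ad bd; rewrite !ltr_norml => /andP[? ?] /andP[? ?]; apply/andP; split; lra.
  - by rewrite mul0r => /eqP; rewrite subr_eq0 => /eqP.
have d0 : `|0 : R| < d by apply: le_lt_trans td; rewrite normr0 normr_ge0.
have [t0|t0] := leP 0 t; first by rewrite -/(f t) -/(f 0) (fcst 0 t).
by rewrite -/(f t) -/(f 0) (fcst t 0)// ltW.
Qed.

Lemma differentiable_scale_rV (R : realType) (V : normedModType R) n
    (k : V -> R) (f : V -> 'rV[R]_n) (x : V) :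
  differentiable k x -> differentiable f x ->
  differentiable (fun y => k y *: f y) x.
Proof.
move=> dk df.
have -> : (fun y => k y *: f y) =
    \sum_(i < n) (fun y => (k y * f y ord0 i) *: (delta_mx ord0 i : 'rV[R]_n)).
  apply/funext => y; rewrite fct_sumE {1}(row_sum_delta (f y)) scaler_sumr.
  by apply: eq_bigr => i _; rewrite scalerA.
apply: differentiable_sum => i.
apply: (@differentiableZl _ _ _ (fun y => k y * f y ord0 i)).
apply: (@differentiableM _ _ k (fun y => f y ord0 i)) => //.
apply: (@differentiable_comp _ _ _ _ f (fun M : 'rV[R]_n => M ord0 i)) => //.
exact: differentiable_coord.
Qed.

Lemma is_derive_line (R : realType) (V : normedModType R) (X : V) (t : R) :
  is_derive t 1 (fun t : R => t *: X) X.
Proof.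
have ds := is_diff_scalel t X.
split; first exact: (proj2 (derivable1_diffP _ _) ex_diff).
by rewrite deriveE ?diff_val ?scale1r//; exact: ex_diff.
Qed.

Lemma is_derive_along_line (R : realType) (V W : normedModType R) (F : V -> W) (X : V) :
  differentiable F 0 -> is_derive (0 : R) 1 (fun t : R => F (t *: X)) ('d F 0 X).
Proof.
move=> dF; have dF' : differentiable F ((0 : R) *: X) by rewrite scale0r.
by have := is_derive_comp_diff (is_derive_line X 0) dF'; rewrite scale0r.
Qed.

(** * Lie groups: charts and velocities *)

Section LieGroup.
Context (R : realType) (n : nat) (G : topGroupType) (A : set (chart R n G)).
Context (c : chart R n G).
Hypothesis hL : lie_group A.
Hypothesis Ac : A c.
Hypothesis c1 : dom c 1%g.
Local Notation e0 := (crd c 1%g).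

Lemma lie_is_chart a : A a -> is_chart a.
Proof. by have [[_ _ [h _ _]] _ _ _ _] := hL; exact: h. Qed.

Lemma lie_hausdorff : hausdorff_space G.
Proof. by have [[h _ _] _ _ _ _] := hL. Qed.

Lemma chartK a g : A a -> dom a g -> par a (crd a g) = g.
Proof. by move=> /lie_is_chart[_ _ h _ _]; exact: h. Qed.

Lemma chart_cod (a : chart R n G) g : dom a g -> cod a (crd a g).
Proof. by move=> ag; exists g. Qed.

Lemma chart_dom_nbhs a g : A a -> dom a g -> nbhs g (dom a).
Proof. by move=> /lie_is_chart[h _ _ _ _] ag; exact: open_nbhs_nbhs. Qed.

Lemma chart_crd_cts a g : A a -> dom a g -> {for g, continuous (crd a)}.
Proof. by move=> /lie_is_chart[_ _ _ h _]; exact: h. Qed.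

Lemma chart_par_cts a g : A a -> dom a g -> par a @ crd a g --> g.
Proof.
move=> Aa ag; rewrite -{2}(chartK Aa ag).
by have [_ _ _ _ h] := lie_is_chart Aa; apply: h; exact: chart_cod.
Qed.

Lemma chart_cod_nbhs a g : A a -> dom a g -> nbhs (crd a g) (cod a).
Proof.
move=> /lie_is_chart[_ h _ _ _] ag.
by apply: open_nbhs_nbhs; split => //; exact: chart_cod.
Qed.

Lemma chart_parK a y : A a -> cod a y -> crd a (par a y) = y.
Proof. by move=> Aa [g ag <-]; rewrite chartK. Qed.

Lemma chart_at g : exists2 a, A a & dom a g.
Proof. by have [[_ _ [_ h _]] _ _ _ _] := hL; exact: h. Qed.

Lemma lie_mul_cvg T (F : set_system T) (FF : Filter F) (f g : T -> G) a b :
  f @ F --> a -> g @ F --> b -> (fun t => (f t * g t)%g) @ F --> (a * b)%g.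
Proof.
move=> fa gb; apply: (@continuous2_cvg _ _ _ _ _ _ f g (fun x y : G => (x * y)%g)) => //.
by have [_ h _ _ _] := hL; exact: (h (a, b)).
Qed.

Lemma lie_inv_cvg T (F : set_system T) (FF : Filter F) (f : T -> G) a :
  f @ F --> a -> (fun t => (f t)^-1%g) @ F --> (a^-1)%g.
Proof.
by have [_ _ h _ _] := hL => fa; apply: continuous_cvg => //; exact: h.
Qed.

Definition chart_mul (a b d : chart R n G) (p : 'rV[R]_n * 'rV[R]_n) : 'rV[R]_n :=
  crd d (par a p.1 * par b p.2)%g.

Definition chart_inv (a b : chart R n G) (x : 'rV[R]_n) : 'rV[R]_n :=
  crd b ((par a x)^-1)%g.

Lemma chart_mul_diff a b d g h : A a -> A b -> A d ->
  dom a g -> dom b h -> dom d (g * h)%g ->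
  differentiable (chart_mul a b d) (crd a g, crd b h).
Proof.
move=> Aa Ab Ad ag bh dgh; have [_ _ _ sm _] := hL.
have [+ _] := sm a b d Aa Ab Ad 1%N; apply.
by split; [exact: chart_cod|exact: chart_cod|rewrite /= !chartK].
Qed.

Lemma chart_mul_derive_diff a b d g h v : A a -> A b -> A d ->
  dom a g -> dom b h -> dom d (g * h)%g ->
  differentiable (fun p => 'D_v (chart_mul a b d) p) (crd a g, crd b h).
Proof.
move=> Aa Ab Ad ag bh dgh; have [_ _ _ sm _] := hL.
have [_ /(_ v) [+ _]] := sm a b d Aa Ab Ad 2%N; apply.
by split; [exact: chart_cod|exact: chart_cod|rewrite /= !chartK].
Qed.

Lemma chart_inv_diff a b g : A a -> A b -> dom a g -> dom b (g^-1)%g ->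
  differentiable (chart_inv a b) (crd a g).
Proof.
move=> Aa Ab ag bg; have [_ _ _ _ sm] := hL.
have [+ _] := sm a b Aa Ab 1%N; apply.
by split; [exact: chart_cod|rewrite /= !chartK].
Qed.

Definition chart_trans (g h : G) (x : 'rV[R]_n) : 'rV[R]_n :=
  crd c (g * par c x * h)%g.

Lemma par_c_cvg : par c @ e0 --> 1%g.
Proof. exact: chart_par_cts. Qed.

Lemma chart_trans_diff g h : dom c (g * h)%g -> differentiable (chart_trans g h) e0.
Proof.
move=> cgh; have [a Aa ag] := chart_at g; have [b Ab bh] := chart_at h.
pose f1 x := chart_mul a c a (crd a g, x).
pose f2 y := chart_mul a b c (y, crd b h).
have f1e : f1 e0 = crd a g by rewrite /f1 /chart_mul /= !chartK// mulg1.
have df1 : differentiable f1 e0.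
  apply: (@differentiable_comp _ _ _ _ (fun x => (crd a g, x)) (chart_mul a c a)).
    by apply: differentiable_pair => //; exact: differentiable_cst.
  by apply: chart_mul_diff => //; rewrite mulg1.
have df2 : differentiable f2 (f1 e0).
  rewrite f1e.
  apply: (@differentiable_comp _ _ _ _ (fun y => (y, crd b h)) (chart_mul a b c)).
    by apply: differentiable_pair => //; exact: differentiable_cst.
  by apply: chart_mul_diff.
have df := differentiable_comp df1 df2.
apply: (proj1 (near_eq_diff _ df)).
have : \forall x \near e0, dom a (g * par c x)%g.
  have gc : (fun x => g * par c x)%g @ e0 --> g.
    rewrite -[X in _ --> X]mulg1.
    by apply: (@lie_mul_cvg _ _ _ (fun=> g) (par c)) par_c_cvg; exact: cvg_cst.
  by apply: gc; exact: chart_dom_nbhs.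
apply: filterS => x ax.
by rewrite /= /f2 /f1 /chart_mul /chart_trans /= (chartK Ab)// (chartK Aa ag) chartK.
Qed.

(** The product restricts to the identity on each of the two factors through the
    identity element, so its differential there is the sum. *)
Lemma chart_mul_diff1 (X Y : 'rV[R]_n) :
  'd (chart_mul c c c) (e0, e0) (X, Y) = X + Y.
Proof.
have dM : differentiable (chart_mul c c c) (e0, e0).
  by apply: chart_mul_diff => //; rewrite mulg1.
have did : differentiable (id : 'rV[R]_n -> 'rV[R]_n) e0 by exact: ex_diff.
have -> : (X, Y) = (X, 0) + (0, Y) 
  by apply: injective_projections; rewrite /= ?addr0 ?add0r.
rewrite linearD; congr (_ + _).
  have dp : is_diff e0 (fun x : 'rV[R]_n => (x, e0)) (fun x => (x, 0)).
    exact: is_diff_pair.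
  have d1 : differentiable (fun x : 'rV[R]_n => (x, e0)) e0 by exact: ex_diff.
  have -> : (X, 0) = 'd (fun x : 'rV[R]_n => (x, e0)) e0 X by rewrite diff_val.
  rewrite -[LHS]/(('d (chart_mul c c c) (e0, e0) \o _) X) -diff_comp//.
  have En : \forall y \near e0, id y = (chart_mul c c c \o (fun x : 'rV[R]_n => (x, e0))) y.
    apply: filterS (chart_cod_nbhs Ac c1) => x cx.
    by rewrite /chart_mul /= (chartK Ac c1) mulg1 chart_parK.
  have [_ Ed] := near_eq_diff En did.
  by rewrite Ed diff_val.
have dp : is_diff e0 (fun x : 'rV[R]_n => (e0, x)) (fun x => (0, x)).
  exact: is_diff_pair.
have d1 : differentiable (fun x : 'rV[R]_n => (e0, x)) e0 by exact: ex_diff.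
have -> : (0, Y) = 'd (fun x : 'rV[R]_n => (e0, x)) e0 Y by rewrite diff_val.
rewrite -[LHS]/(('d (chart_mul c c c) (e0, e0) \o _) Y) -diff_comp//.
have En : \forall y \near e0, id y = (chart_mul c c c \o (fun x : 'rV[R]_n => (e0, x))) y.
  apply: filterS (chart_cod_nbhs Ac c1) => x cx.
  by rewrite /chart_mul /= (chartK Ac c1) mul1g chart_parK.
have [_ Ed] := near_eq_diff En did.
by rewrite Ed diff_val.
Qed.

Record velocity (f : R -> G) (X : 'rV[R]_n) : Prop := Velocity {
  vel_at0 : f 0 = 1%g;
  vel_cvg : f @ (0 : R) --> 1%g;
  vel_der : is_derive (0 : R) 1 (fun t => crd c (f t)) X }.

Lemma vel_inj f X Y : velocity f X -> velocity f Y -> X = Y.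
Proof. by move=> [_ _ fX] [_ _ fY]; exact: is_derive_inj fX fY. Qed.

Lemma vel_near f X : velocity f X -> \forall t \near (0 : R), dom c (f t).
Proof. by move=> [_ fc _]; apply: fc; exact: chart_dom_nbhs. Qed.

Lemma vel_trans f X g h : velocity f X -> dom c (g * h)%g ->
  is_derive (0 : R) 1 (fun t => crd c (g * f t * h)%g) ('d (chart_trans g h) e0 X).
Proof.
move=> fX cgh; have [f0 fc fd] := fX.
have dt := chart_trans_diff cgh.
have dt0 : differentiable (chart_trans g h) (crd c (f 0)) by rewrite f0.
have := is_derive_comp_diff fd dt0; rewrite f0.
apply: near_eq_is_derive; apply: filterS (vel_near fX) => t ct.
by rewrite /= /chart_trans chartK.
Qed.

Lemma vel_conj f X g : velocity f X ->
  velocity (fun t => g * f t * g^-1)%g (Ad c g X).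
Proof.
move=> fX; have [f0 fc fd] := fX.
have cgg : dom c (g * g^-1)%g by rewrite mulgV.
split; first by rewrite f0 mulg1 mulgV.
  rewrite -[X in _ --> X](mulgV g) -[X in _ --> (X * _)%g]mulg1.
  apply: (@lie_mul_cvg _ _ _ (fun t => (g * f t)%g) (fun=> g^-1)%g); last exact: cvg_cst.
  by apply: (@lie_mul_cvg _ _ _ (fun t => g) f) => //; exact: cvg_cst.
by have := vel_trans fX cgg; rewrite -deriveE//; exact: chart_trans_diff.
Qed.

Lemma vel_mul f h X Y : velocity f X -> velocity h Y ->
  velocity (fun t => f t * h t)%g (X + Y).
Proof.
move=> fX hY; have [f0 fc fd] := fX; have [h0 hc hd] := hY.
split; first by rewrite f0 h0 mulg1.
  by rewrite -[X in _ --> X](mulg1 1%g); exact: lie_mul_cvg.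
have dM : differentiable (chart_mul c c c) (crd c (f 0), crd c (h 0)).
  by apply: chart_mul_diff; rewrite ?f0 ?h0// mulg1.
have dp := is_derive_pair fd hd.
have := is_derive_comp_diff dp dM; rewrite f0 h0 chart_mul_diff1.
apply: near_eq_is_derive; apply: filterS2 (vel_near fX) (vel_near hY) => t ct dt.
by rewrite /= /chart_mul /= !chartK.
Qed.

Lemma vel_scale f X (phi : R -> R) (a : R) : velocity f X ->
  phi 0 = 0 -> is_derive (0 : R) 1 phi a -> velocity (f \o phi) (a *: X).
Proof.
move=> [f0 fc fd] p0 dphi; have pc := is_derive_cvg dphi.
split; first by rewrite /= p0.
  by rewrite p0 in pc; exact: cvg_comp pc fc.
have [df Df] := fd.
have dF0 := proj1 (derivable1_diffP _ _) df.
have dF : differentiable (fun t => crd c (f t)) (phi 0) by rewrite p0; exact: dF0.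
have := is_derive_comp_diff dphi dF; rewrite p0.
rewrite p0 in dF.
have -> : 'd (fun t => crd c (f t)) 0 a = a *: X.
  by rewrite -[a in LHS]mulr1 -[a * 1]/(a *: 1) linearZ /= -(deriveE _ dF0) Df.
by [].
Qed.

(** * One-parameter subgroups *)

Lemma ops_velocity f X : one_parameter_subgroup f ->
  is_derive (0 : R) 1 (fun t => crd c (f t)) X -> velocity f X.
Proof.
move=> [fc fM] fX; have f0 : f 0 = 1%g.
  by apply: (mulgI (f 0)); rewrite mulg1 -fM addr0.
by split => //; rewrite -f0; exact: fc.
Qed.

Lemma ops0 (f : R -> G) : one_parameter_subgroup f -> f 0 = 1%g.
Proof. by move=> [fc fM]; apply: (mulgI (f 0)); rewrite mulg1 -fM addr0. Qed.

Lemma opsN (f : R -> G) t : one_parameter_subgroup f -> f (- t) = (f t)^-1%g.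
Proof.
by move=> fo; apply: (mulgI (f t)); rewrite mulgV -(proj2 fo) subrr ops0.
Qed.

Lemma ops_mulrn (f : R -> G) t j : one_parameter_subgroup f ->
  f (t *+ j) = (f t ^+ j)%g.
Proof.
move=> fo; elim: j => [|j IH]; first by rewrite mulr0n expg0 ops0.
by rewrite mulrS (proj2 fo) IH expgS.
Qed.

(** Every t is a multiple of a small time. *)
Lemma ops_eq_near (f h : R -> G) (d : R) : 0 < d ->
  one_parameter_subgroup f -> one_parameter_subgroup h ->
  (forall t, `|t| < d -> f t = h t) -> forall t, f t = h t.
Proof.
move=> d0 fo ho fh t; pose j := (Num.truncn (`|t| / d)).+1.
have j0 : 0 < j%:R :> R by [].
have -> : t = (t / j%:R) *+ j by rewrite -mulr_natr divfK ?gt_eqF.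
rewrite !ops_mulrn// fh// normrM normfV (ger0_norm (ltW j0)) ltr_pdivrMr//.
by rewrite mulrC -ltr_pdivrMr// truncnS_gt.
Qed.

(** The curve [q t = f t * h (- t)] satisfies
    [q (s + t) = f s * q t * h (- s)], and [q] has velocity 0 at the identity.
    Hence its chart coordinates have derivative 0 at all small times. *)
Lemma ops_unique (f h : R -> G) X : one_parameter_subgroup f ->
  one_parameter_subgroup h -> velocity f X -> velocity h X ->
  forall t, f t = h t.
Proof.
move=> fo ho fX hX; pose q t := (f t * h (- t))%g.
have hN : velocity (fun t => h (- t)) (- X).
  rewrite -scaleN1r; apply: (@vel_scale h X -%R (-1) hX).
  by rewrite oppr0.
have q0 : velocity q 0 by rewrite -(subrr X); exact: vel_mul.
have [d /= d0 dq] := vel_near q0.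
have {}dq t : `|t| < d -> dom c (q t).
  by move=> td; apply: dq; rewrite /ball_ /= sub0r normrN.
apply: (ops_eq_near d0 fo ho) => t td.
have qder (s : R) : `|s| < d -> is_derive s 1 (fun t => crd c (q t)) 0.
  move=> sd; apply: is_derive_at_shift.
  have -> : (fun e => crd c (q (e + s))) = (fun e => crd c (f s * q e * h (- s))%g).
    apply/funext => e; congr (crd c _).
    by rewrite /q opprD (proj2 ho) addrC (proj2 fo) !mulgA.
  by have := vel_trans q0 (dq s sd); rewrite linear0.
have qcst := derive0_cst qder td.
have /(congr1 (par c)) := qcst; rewrite (vel_at0 q0) !chartK//; last exact: dq.
by rewrite /q opsN// => /divg1_eq.
Qed.

(** * Exponential map and adjoint representation *)

Context (exp : 'rV[R]_n -> G).
Hypothesis hexp : is_exp c exp.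

Lemma exp_ops X : one_parameter_subgroup (fun t : R => exp (t *: X)).
Proof. by have [] := hexp X. Qed.

Lemma exp_vel X : velocity (fun t : R => exp (t *: X)) X.
Proof. by apply: ops_velocity; have [] := hexp X. Qed.

Lemma exp0 : exp 0 = 1%g.
Proof. by rewrite -(scale0r 0) (ops0 (exp_ops 0)). Qed.

Lemma exp_eq_germ X Y : (forall t : R, exp (t *: X) = exp (t *: Y)) -> X = Y.
Proof.
move=> XY; apply: (vel_inj (exp_vel X)).
by rewrite (_ : (fun t : R => exp (t *: X)) = (fun t : R => exp (t *: Y)));
  [exact: exp_vel|exact/funext].
Qed.

Lemma expDl s t X : exp ((s + t) *: X) = (exp (s *: X) * exp (t *: X))%g.
Proof. by have [_ h] := exp_ops X; exact: h. Qed.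

Lemma expN X : exp (- X) = (exp X)^-1%g.
Proof. by have := opsN 1 (exp_ops X); rewrite scaleN1r scale1r. Qed.

Lemma ops_exp f X : one_parameter_subgroup f -> velocity f X ->
  forall t, f t = exp (t *: X).
Proof. by move=> fo fX; apply: ops_unique fX (exp_vel X) => //; exact: exp_ops. Qed.

(** Conjugating a one-parameter subgroup by [g] gives a one-parameter subgroup
    whose velocity is, by definition, [Ad c g Y]. *)
Lemma exp_conj g Y : exp (Ad c g Y) = (g * exp Y * g^-1)%g.
Proof.
have fo : one_parameter_subgroup (fun t : R => g * exp (t *: Y) * g^-1)%g.
  split=> [t|s t]; last by rewrite expDl !mulgA mulgVK.
  have [ec _] := exp_ops Y.
  apply: (@lie_mul_cvg _ _ _ (fun t => (g * exp (t *: Y))%g) (fun=> g^-1)%g); last exact: cvg_cst.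
  by apply: (@lie_mul_cvg _ _ _ (fun t => g) (fun t => exp (t *: Y)));
    [exact: cvg_cst|exact: ec].
have := ops_exp fo (vel_conj g (exp_vel Y)) 1.
by rewrite !scale1r.
Qed.

Lemma Ad_diffE g Y : Ad c g Y = 'd (chart_trans g (g^-1)%g) e0 Y.
Proof. by rewrite -deriveE//; apply: chart_trans_diff; rewrite mulgV. Qed.

Lemma AdD g X Y : Ad c g (X + Y) = Ad c g X + Ad c g Y.
Proof. by rewrite !Ad_diffE linearD. Qed.

Lemma AdZ g a X : Ad c g (a *: X) = a *: Ad c g X.
Proof. by rewrite !Ad_diffE linearZ. Qed.

Lemma Ad0 g : Ad c g 0 = 0.
Proof. by rewrite Ad_diffE linear0. Qed.

(** A vector is determined by its one-parameter subgroup, so the identity can be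
    checked after exponentiation. *)
Lemma AdM g h X : Ad c (g * h)%g X = Ad c g (Ad c h X).
Proof.
apply: exp_eq_germ => t; rewrite -!AdZ !exp_conj.
by rewrite invgM !mulgA.
Qed.

Lemma Ad1 X : Ad c 1%g X = X.
Proof. by apply: exp_eq_germ => t; rewrite -!AdZ exp_conj invg1 mulg1 mul1g. Qed.

Local Notation M := (chart_mul c c c).

(** Conjugation is the composite of two products, which the chain rule
    differentiates.  The outer derivative is expanded along a basis so that the
    point [crd c g] occurs only in derivatives along fixed directions. *)
Lemma Ad_formula g Y : dom c g -> dom c (g^-1)%g ->
  Ad c g Y = \sum_i ('D_(0, Y) M (crd c g, e0)) ord0 i *:
    'D_(delta_mx ord0 i : 'rV[R]_n, 0 : 'rV[R]_n) M (crd c g, crd c (g^-1)%g).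
Proof.
move=> cg cg'.
have dM1 : differentiable M (crd c g, e0) by apply: chart_mul_diff; rewrite ?mulg1.
have dM2 : differentiable M (crd c g, crd c (g^-1)%g).
  by apply: chart_mul_diff; rewrite ?mulgV.
have dp1 : is_diff e0 (fun y : 'rV[R]_n => (crd c g, y)) (fun y => (0, y)).
  exact: is_diff_pair.
have Dp1 : differentiable (fun y : 'rV[R]_n => (crd c g, y)) e0 by exact: ex_diff.
pose f1 (y : 'rV[R]_n) := M (crd c g, y).
have f1e : f1 e0 = crd c g by rewrite /f1 /chart_mul /= !chartK// mulg1.
have df1 : differentiable f1 e0 by exact: (differentiable_comp Dp1 dM1).
have df1E : 'd f1 e0 Y = 'D_(0, Y) M (crd c g, e0).
  rewrite (deriveE _ dM1) (diff_comp Dp1 dM1) /=; congr ('d _ _ _).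
  by rewrite diff_val.
have dp2 : is_diff (crd c g) (fun y : 'rV[R]_n => (y, crd c (g^-1)%g)) (fun y => (y, 0)).
  exact: is_diff_pair.
have Dp2 : differentiable (fun y : 'rV[R]_n => (y, crd c (g^-1)%g)) (f1 e0).
  by rewrite f1e; exact: ex_diff.
pose f2 (y : 'rV[R]_n) := M (y, crd c (g^-1)%g).
have df2 : differentiable f2 (f1 e0).
  by apply: (differentiable_comp Dp2); rewrite /= f1e.
have En : \forall y \near e0, f2 (f1 y) = chart_trans g (g^-1)%g y.
  have gc : (fun x => g * par c x)%g @ e0 --> g.
    rewrite -[X in _ --> X]mulg1.
    by apply: (@lie_mul_cvg _ _ _ (fun=> g) (par c)) par_c_cvg; exact: cvg_cst.
  have gN : \forall y \near e0, dom c (g * par c y)%g.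
    by apply: gc; exact: chart_dom_nbhs.
  apply: filterS gN => y cy.
  by rewrite /= /f2 /f1 /chart_mul /chart_trans /= (chartK Ac cg) !chartK.
have [_ Ed] := near_diff_comp df1 df2 En.
pose w := 'D_(0, Y) M (crd c g, e0).
have E1 := etrans (Ad_diffE g Y) (etrans (Ed Y) (congr1 ('d f2 (f1 e0)) df1E)).
have Dp2' : differentiable (fun y : 'rV[R]_n => (y, crd c (g^-1)%g)) (crd c g).
  by rewrite -f1e.
have df2E : 'd f2 (f1 e0) w = 'd M (crd c g, crd c (g^-1)%g) (w, 0).
  have E2 : \forall y \near crd c g, M (y, crd c (g^-1)%g) = f2 y.
    by apply: filterS (chart_cod_nbhs Ac cg).
  have [_ Ed2] := near_diff_comp Dp2' dM2 E2.
  by rewrite f1e; apply: (etrans (Ed2 w)); rewrite diff_val.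
apply: (etrans E1); apply: (etrans df2E); rewrite -/w.
have -> : (w, 0) = \sum_i w ord0 i *: (delta_mx ord0 i : 'rV[R]_n, 0 : 'rV[R]_n).
  apply: injective_projections.
    rewrite (big_morph fst (id1 := 0) (op1 := +%R))//=; exact: row_sum_delta.
  rewrite (big_morph snd (id1 := 0) (op1 := +%R))//= big1// => i _.
  by rewrite scaler0.
rewrite linear_sum; apply: eq_bigr => i _.
by rewrite linearZ /= deriveE.
Qed.

Lemma Ad_diff Y : differentiable (fun x => Ad c (par c x) Y) e0.
Proof.
have c1' : dom c (1^-1)%g by rewrite invg1.
(* by second order smoothness of the product, every factor of [Ad_formula] is
   differentiable *)
pose F x := \sum_i ('D_(0, Y) M (x, e0)) ord0 i *:
    'D_(delta_mx ord0 i : 'rV[R]_n, 0 : 'rV[R]_n) M (x, chart_inv c c x).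
have En : \forall x \near e0, F x = Ad c (par c x) Y.
  have ic : (fun x => (par c x)^-1)%g @ e0 --> (1^-1)%g.
    exact: (@lie_inv_cvg _ _ _ (par c)) par_c_cvg.
  have h1 : \forall x \near e0, dom c ((par c x)^-1)%g.
    by apply: ic; exact: chart_dom_nbhs.
  have h2 : \forall x \near e0, dom c (par c x).
    by apply: par_c_cvg; exact: chart_dom_nbhs.
  apply: filterS3 h1 h2 (chart_cod_nbhs Ac c1) => x x1 x2 x3.
  by rewrite (Ad_formula Y x2 x1) (chart_parK Ac x3).
apply: (proj1 (near_eq_diff En _)).
have -> : F = \sum_i (fun x => ('D_(0, Y) M (x, e0)) ord0 i *:
    'D_(delta_mx ord0 i : 'rV[R]_n, 0 : 'rV[R]_n) M (x, chart_inv c c x)).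
  by apply/funext => x; rewrite fct_sumE.
apply: differentiable_sum => i; apply: differentiable_scale_rV.
  apply: (@differentiable_comp _ _ _ _ (fun x => 'D_(0, Y) M (x, e0))
    (fun N : 'rV[R]_n => N ord0 i)); last exact: differentiable_coord.
  apply: (@differentiable_comp _ _ _ _ (fun x => (x, e0)) (fun p => 'D_(0, Y) M p)).
    by apply: differentiable_pair => //; exact: differentiable_cst.
  by apply: chart_mul_derive_diff => //; rewrite mulg1.
apply: (@differentiable_comp _ _ _ _ (fun x => (x, chart_inv c c x)) (fun p => 'D__ M p)).
  by apply: differentiable_pair => //; exact: chart_inv_diff.
rewrite /chart_inv (chartK Ac c1).
by apply: chart_mul_derive_diff => //; rewrite mulgV.
Qed.

(** * Lie bracket and product formula *)

Local Notation br := (lie_bracket c).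

Lemma brk_diffE X Y : br X Y = 'd (fun x => Ad c (par c x) Y) e0 X.
Proof. by rewrite -deriveE//; exact: Ad_diff. Qed.

Lemma brkDl X X' Y : br (X + X') Y = br X Y + br X' Y.
Proof. by rewrite !brk_diffE linearD. Qed.

Lemma brkZl a X Y : br (a *: X) Y = a *: br X Y.
Proof. by rewrite !brk_diffE linearZ. Qed.

Lemma Ad_derivable X Y : derivable (fun x => Ad c (par c x) Y) e0 X.
Proof. exact: diff_derivable (Ad_diff Y). Qed.

Lemma brkDr X Y Y' : br X (Y + Y') = br X Y + br X Y'.
Proof.
have E : (fun x => Ad c (par c x) (Y + Y')) =
    (fun x => Ad c (par c x) Y) + (fun x => Ad c (par c x) Y').
  by apply/funext => x; rewrite AdD.
apply: (etrans (congr1 (fun F => 'D_X F e0) E)).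
exact: deriveD (@Ad_derivable X Y) (@Ad_derivable X Y').
Qed.

Lemma brkZr a X Y : br X (a *: Y) = a *: br X Y.
Proof.
have E : (fun x => Ad c (par c x) (a *: Y)) = a *: (fun x => Ad c (par c x) Y).
  by apply/funext => x; rewrite AdZ.
apply: (etrans (congr1 (fun F => 'D_X F e0) E)).
exact: deriveZ (@Ad_derivable X Y).
Qed.

Local Opaque lie_bracket Ad.

Lemma Ad_exp_der0 X Y :
  is_derive (0 : R) 1 (fun t : R => Ad c (exp (t *: X)) Y) (br X Y).
Proof.
have eX := exp_vel X; have [E0 _ de] := eX.
have dA : differentiable (fun x => Ad c (par c x) Y) (crd c (exp (0 *: X))).
  by rewrite E0; exact: Ad_diff.
have := is_derive_comp_diff de dA; rewrite E0 -brk_diffE.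
apply: near_eq_is_derive; apply: filterS (vel_near eX) => t ct.
by rewrite /= chartK.
Qed.

Lemma Ad_differentiable g x : differentiable (Ad c g) x /\ 'd (Ad c g) x = Ad c g :> (_ -> _).
Proof.
have E : Ad c g = 'd (chart_trans g (g^-1)%g) e0 :> (_ -> _).
  by apply/funext => y; exact: Ad_diffE.
have cgg : dom c (g * g^-1)%g by rewrite mulgV.
have ct := diff_continuous (chart_trans_diff cgg).
rewrite E; split; first exact: linear_differentiable.
exact: diff_lin.
Qed.

(** The group property of exp turns the derivative at 0 into the derivative at
    every time. *)
Lemma Ad_exp_der X Y (t : R) :
  is_derive t 1 (fun t : R => Ad c (exp (t *: X)) Y) (Ad c (exp (t *: X)) (br X Y)).
Proof.
apply: is_derive_at_shift.
have -> : (fun e => Ad c (exp ((e + t) *: X)) Y) =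
    Ad c (exp (t *: X)) \o (fun e => Ad c (exp (e *: X)) Y).
  by apply/funext => e; rewrite /= -AdM -expDl addrC.
have [dA EA] := Ad_differentiable (exp (t *: X)) (Ad c (exp (0 *: X)) Y).
have := is_derive_comp_diff (Ad_exp_der0 X Y) dA.
by rewrite EA.
Qed.

Lemma Ad_exp_fix X Y (t : R) : br X Y = 0 -> Ad c (exp (t *: X)) Y = Y.
Proof.
move=> XY0; have t1 : `|t| < `|t| + 1 by rewrite ltrDl.
have dF (s : R) : `|s| < `|t| + 1 ->
    is_derive s 1 (fun s : R => Ad c (exp (s *: X)) Y) 0.
  move=> _; have := Ad_exp_der X Y s.
  by rewrite XY0 Ad0.
by rewrite (derive0_cst dF t1) scale0r exp0 Ad1.
Qed.

(** When [X, [X, Y]] = 0 the curve Ad(exp(t X)) Y has the constant derivative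
    [X, Y]. *)
Lemma Ad_exp_nil X Y (t : R) : br X (br X Y) = 0 ->
  Ad c (exp (t *: X)) Y = Y + t *: br X Y.
Proof.
move=> XXY; have t1 : `|t| < `|t| + 1 by rewrite ltrDl.
pose F (s : R) := Ad c (exp (s *: X)) Y - s *: br X Y.
have dF (s : R) : `|s| < `|t| + 1 -> is_derive s 1 F 0.
  move=> _; have d1 := Ad_exp_der X Y s; rewrite Ad_exp_fix// in d1.
  have d2 := is_derive_line (br X Y) s.
  by rewrite -(subrr (br X Y)); exact: is_deriveB.
have := derive0_cst dF t1; rewrite /F !scale0r exp0 Ad1 subr0 => /eqP.
by rewrite subr_eq => /eqP.
Qed.

(** The elements exp(t X) commute, so Ad(exp(t X)) fixes X. *)
Lemma brkxx X : br X X = 0.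
Proof.
have := Ad_exp_der0 X X.
have -> : (fun t : R => Ad c (exp (t *: X)) X) = (fun=> X).
  apply/funext => t; apply: exp_eq_germ => s; rewrite -AdZ exp_conj.
  by rewrite -expDl addrC expDl mulgK.
move=> d1; apply: is_derive_inj d1 _; exact: is_derive_cst.
Qed.

Lemma brk_anti X Y : br X Y = - br Y X.
Proof.
have h1 := brkxx (X + Y).
have h2 := brkDl X Y (X + Y).
have h3 := brkDr X X Y.
have h4 := brkDr Y X Y.
have h5 := brkxx X.
have h6 := brkxx Y.
move: h1 h2 h3 h4 h5 h6.
move: (br (X + Y) (X + Y)) (br X (X + Y)) (br Y (X + Y)).
move: (br X X) (br Y Y).
move: (br X Y) (br Y X) => u v w1 w2 w3 w4 w5 -> h2 h3 h4 h5 h6.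
move: h2; rewrite h3 h4 h5 h6 add0r addr0 => /esym/eqP.
by rewrite addr_eq0 => /eqP.
Qed.

Lemma brk0r X : br X 0 = 0.
Proof. by have := brkZr 0 X 0; rewrite !scale0r. Qed.

Lemma exp_commute X Y : br X Y = 0 -> commute (exp X) (exp Y).
Proof.
move=> XY; have := Ad_exp_fix 1 XY; rewrite scale1r => /(congr1 exp).
by rewrite exp_conj => h; rewrite /commute -[in RHS]h mulgVK.
Qed.

Lemma brk_commute X Y :
  (forall s t : R, commute (exp (s *: X)) (exp (t *: Y))) -> br X Y = 0.
Proof.
move=> XY; have := Ad_exp_der0 X Y.
have -> : (fun t : R => Ad c (exp (t *: X)) Y) = (fun=> Y).
  apply/funext => t; apply: exp_eq_germ => s; rewrite -AdZ exp_conj.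
  by rewrite XY mulgK.
move=> d1; apply: is_derive_inj d1 _; exact: is_derive_cst.
Qed.

Lemma ops_mul_cts (f h : R -> G) : one_parameter_subgroup f -> one_parameter_subgroup h ->
  continuous (fun t : R => f t * h t)%g.
Proof.
by move=> [fc _] [hc _] t; apply: (@lie_mul_cvg _ _ _ f h); [exact: fc|exact: hc].
Qed.

Lemma exp_add_commute X Y : br X Y = 0 -> exp (X + Y) = (exp X * exp Y)%g.
Proof.
move=> XY; pose f (t : R) := (exp (t *: X) * exp (t *: Y))%g.
have fo : one_parameter_subgroup f.
  split; first exact: ops_mul_cts (exp_ops X) (exp_ops Y).
  move=> s t; rewrite /f !expDl !mulgA; congr (_ * _)%g; rewrite -!mulgA; congr (_ * _)%g.
  by apply: exp_commute; rewrite (brkZl _ X) (brkZr _ X Y) XY !scaler0.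
have := ops_exp fo (vel_mul (exp_vel X) (exp_vel Y)) 1.
by rewrite /f !scale1r.
Qed.

(** The Baker-Campbell-Hausdorff formula when [X, Y] commutes with X and Y:
    commuting exp(s X) past exp(t Y) costs the factor exp(s t [X, Y]). *)
Lemma exp_mul_step2 X Y : br X (br X Y) = 0 -> br Y (br X Y) = 0 ->
  (exp X * exp Y)%g = exp (X + Y + 2^-1 *: br X Y).
Proof.
move=> XXY YXY; have AY (s : R) := Ad_exp_nil s XXY.
move: (br X Y) XXY YXY AY => W XW YW AY.
have swap (s t : R) : (exp (s *: X) * exp (t *: Y) =
    exp (t *: Y) * exp (s *: X) * exp ((s * t) *: W))%g.
  have h : exp (t *: Y + (s * t) *: W) = (exp (s *: X) * exp (t *: Y) * (exp (s *: X))^-1)%g.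
    by rewrite -exp_conj (AdZ _ t Y) AY scalerDr scalerA (mulrC t).
  rewrite -[LHS](mulgVK (exp (s *: X))) -h exp_add_commute; last first.
    by rewrite (brkZl _ Y) (brkZr _ Y W) YW !scaler0.
  rewrite -!mulgA; congr (_ * _)%g.
  by symmetry; apply: exp_commute; rewrite (brkZl _ X) (brkZr _ X W) XW !scaler0.
have cX (s t : R) : commute (exp (s *: W)) (exp (t *: X)).
  by symmetry; apply: exp_commute; rewrite (brkZl _ X) (brkZr _ X W) XW !scaler0.
have cY (s t : R) : commute (exp (s *: W)) (exp (t *: Y)).
  by symmetry; apply: exp_commute; rewrite (brkZl _ Y) (brkZr _ Y W) YW !scaler0.
(* the last factor compensates for the reordering in [f s * f t], which makes
   [f] a one-parameter subgroup; being quadratic, it does not change the velocity *)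
pose f (t : R) := (exp (t *: X) * exp (t *: Y) * exp ((- (t ^+ 2 / 2)) *: W))%g.
have dphi : is_derive (0 : R) 1 (fun t : R => - (t ^+ 2 / 2)) 0.
  have -> : (fun t : R => - (t ^+ 2 / 2)) = horner (- (2^-1 *: 'X^2)).
    by apply/funext => t; rewrite !hornerE /=; ring.
  have := is_derive_poly (- (2^-1 *: 'X^2) : {poly R}) (0 : R).
  by rewrite derivN derivZ derivXn !hornerE /= !(mul0rn, mulr0, oppr0).
have fv : velocity f (X + Y).
  rewrite (_ : X + Y = X + Y + 0 *: W); last by rewrite scale0r addr0.
  apply: vel_mul; first exact: vel_mul (exp_vel X) (exp_vel Y).
  apply: (@vel_scale (fun t : R => exp (t *: W)) W (fun t : R => - (t ^+ 2 / 2)) 0 (exp_vel W)) => //.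
  by rewrite expr0n /= mul0r oppr0.
have fM s t : f (s + t) = (f s * f t)%g.
  rewrite /f !expDl.
  have -> : - ((s + t) ^+ 2 / 2) = - (s * t) + (- (s ^+ 2 / 2) + - (t ^+ 2 / 2)) :> R.
    by field.
  rewrite !expDl.
  have h := swap t s; have hw : (exp ((t * s) *: W) * exp (- (s * t) *: W) = 1)%g.
    by rewrite -expDl mulrC subrr scale0r exp0.
  have cwY := cY (t * s) t; have c2X := cX (- (s ^+ 2 / 2)) t.
  have c2Y := cY (- (s ^+ 2 / 2)) t.
  move: (exp (s *: X)) (exp (t *: X)) (exp (s *: Y)) (exp (t *: Y))
    (exp ((t * s) *: W)) (exp (- (s * t) *: W)) (exp (- (s ^+ 2 / 2) *: W))
    (exp (- (t ^+ 2 / 2) *: W)) h hw cwY c2X c2Y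
    => a b p q w w1 w2 w3 h hw cwY c2X c2Y.
  transitivity (a * (b * p) * q * w1 * w2 * w3)%g; first by rewrite !mulgA.
  rewrite h; transitivity (a * p * b * (w * q) * w1 * w2 * w3)%g; first by rewrite !mulgA.
  rewrite cwY; transitivity (a * p * b * q * (w * w1) * w2 * w3)%g; first by rewrite !mulgA.
  rewrite hw mulg1; transitivity (a * p * (w2 * b) * q * w3)%g; last by rewrite !mulgA.
  rewrite c2X; transitivity (a * p * b * (w2 * q) * w3)%g; last by rewrite !mulgA.
  by rewrite c2Y !mulgA.
have fc : continuous f.
  move=> t; apply: (@lie_mul_cvg _ _ _ (fun t => exp (t *: X) * exp (t *: Y))%g
    (fun t => exp (- (t ^+ 2 / 2) *: W))).
    exact: ops_mul_cts (exp_ops X) (exp_ops Y) t.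
  have [wc _] := exp_ops W.
  apply: (@cvg_comp _ _ _ (fun t : R => - (t ^+ 2 / 2)) (fun t => exp (t *: W))); last exact: wc.
  by apply: cvgN; apply: cvgMr_tmp; exact: exprn_continuous.
have := ops_exp (conj fc fM) fv 1.
rewrite /f !scale1r expr1n mul1r => E.
have cW : br (X + Y) (2^-1 *: W) = 0 by rewrite (brkZr _ _ W) (brkDl X Y W) XW YW addr0 scaler0.
by rewrite exp_add_commute// -E -mulgA -expDl addNr scale0r exp0 mulg1.
Qed.

(** * Stratifications of step two *)

Lemma brk_step2 : step2_bracket br.
Proof. by split; [exact: brkDl|exact: brkZl|exact: brk_anti]. Qed.

Context (V : nat -> {vspace 'rV[R]_n}).
Hypothesis hV : stratification br 2 V.

Lemma strat_decomp X : exists X1 X2, [/\ X1 \in V 1%N, X2 \in V 2%N & X = X1 + X2].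
Proof.
have [+ _ _ _ _] := hV; rewrite !big_ord_recl big_ord0 addv0 => VE.
have : X \in (V 1%N + V 2%N)%VS by rewrite VE memvf.
by move=> /memv_addP[X1 V1 [X2 V2 E]]; exists X1, X2.
Qed.

Lemma strat_brk11 X Y : X \in V 1%N -> Y \in V 1%N -> br X Y \in V 2%N.
Proof. by have [_ _ _ _ /(_ 1%N isT)[h _]] := hV; exact: h. Qed.

Lemma strat_brk12 X Y : X \in V 1%N -> Y \in V 2%N -> br X Y = 0.
Proof.
have [_ _ _ V3 /(_ 2%N isT)[h _]] := hV => X1 Y2.
by have := h X Y X1 Y2; rewrite V3 memv0 => /eqP.
Qed.

Definition brkl (X : 'rV[R]_n) : 'rV[R]_n -> 'rV[R]_n := fun Y => br X Y.

Lemma brkl_linear X : linear (brkl X).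
Proof. by move=> a Y Z; rewrite /brkl (brkDr X (a *: Y) Z) (brkZr a X Y). Qed.

HB.instance Definition _ X := GRing.isLinear.Build R 'rV[R]_n 'rV[R]_n *:%R (brkl X) (brkl_linear X).

(** A bracket of horizontal vectors exponentiates to a product of exponentials of
    horizontal vectors, and these commute with exp(V2).  The vectors that commute
    with [X] form a subspace, which contains V2 because such brackets span it. *)
Lemma strat_brk22 X Y : X \in V 2%N -> Y \in V 2%N -> br X Y = 0.
Proof.
move=> X2; have X1 Z : Z \in V 1%N -> br X Z = 0.
  by move=> Z1; rewrite brk_anti strat_brk12// oppr0.
have [_ _ _ _ /(_ 1%N isT)[_ hmin]] := hV.
pose K := lker (linfun (brkl X)).
have /subvP KV : (V 2%N <= K)%VS.
  apply: hmin => S T S1 T1; rewrite memv_ker lfunE /= /brkl; apply/eqP.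
  apply: brk_commute => s t.
  have sS : s *: X \in V 2%N by rewrite memvZ.
  have comm1 Z : Z \in V 1%N -> commute (exp (s *: X)) (exp Z).
    by move=> Z1; apply: exp_commute; rewrite (brkZl s X Z) (X1 Z Z1) scaler0.
  pose T' := t *: T; have T'1 : T' \in V 1%N by rewrite memvZ.
  have W2 : br S T' \in V 2%N by exact: strat_brk11.
  have -> : t *: br S T = br S T' by rewrite -(brkZr t S T).
  have h1 : exp (Ad c (exp S) T') = (exp S * exp T' * (exp S)^-1)%g by exact: exp_conj.
  have h2 : Ad c (exp S) T' = T' + br S T'.
    have := @Ad_exp_nil S T' 1 (strat_brk12 S1 W2).
    by move: (br S T') => W; rewrite !scale1r.
  have h3 : exp (T' + br S T') = (exp T' * exp (br S T'))%g.
    by apply: exp_add_commute; exact: strat_brk12.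
  have -> : exp (br S T') = ((exp T')^-1 * (exp S * exp T' * (exp S)^-1))%g.
    by rewrite -h1 h2 h3 mulKg.
  apply: commuteM; first by apply: commuteV; exact: comm1.
  apply: commuteM; first by apply: commuteM; exact: comm1.
  by apply: commuteV; exact: comm1.
by move=> /KV; rewrite memv_ker lfunE /= /brkl => /eqP.
Qed.

Lemma strat_brk_reduce X Y X1 X2 Y1 Y2 : X1 \in V 1%N -> X2 \in V 2%N ->
  Y1 \in V 1%N -> Y2 \in V 2%N -> X = X1 + X2 -> Y = Y1 + Y2 ->
  br X Y = br X1 Y1.
Proof.
move=> X1V X2V Y1V Y2V -> ->; rewrite (brkDl X1 X2) (brkDr X1 Y1 Y2) (brkDr X2 Y1 Y2).
rewrite (strat_brk12 X1V Y2V) (strat_brk22 X2V Y2V) (brk_anti X2 Y1).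
by rewrite (strat_brk12 Y1V X2V) oppr0 !addr0.
Qed.

Lemma strat_central X Y : Y \in V 2%N -> br X Y = 0.
Proof.
move=> Y2; have [X1 [X2 [X1V X2V E]]] := strat_decomp X.
have E0 : Y = 0 + Y by rewrite add0r.
by rewrite (strat_brk_reduce X1V X2V (mem0v _) Y2 E E0) brk0r.
Qed.

Lemma brk_in2 X Y : br X Y \in V 2%N.
Proof.
have [X1 [X2 [X1V X2V EX]]] := strat_decomp X.
have [Y1 [Y2 [Y1V Y2V EY]]] := strat_decomp Y.
by rewrite (strat_brk_reduce X1V X2V Y1V Y2V EX EY) strat_brk11.
Qed.

Lemma brk_nil X Y Z : br X (br Y Z) = 0.
Proof. exact: strat_central (brk_in2 Y Z). Qed.

Lemma expM X Y : (exp X * exp Y)%g = exp (X + Y + 2^-1 *: br X Y).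
Proof. by apply: exp_mul_step2; exact: brk_nil. Qed.

Lemma exp_addV2 X Y : Y \in V 2%N -> exp (X + Y) = (exp X * exp Y)%g.
Proof. by move=> Y2; apply: exp_add_commute; exact: strat_central. Qed.

(** * Differentiability of the exponential map at the origin *)

(** This class of maps contains the one-parameter subgroups with differentiable
    parameter and is closed under products.  It therefore gives access to the differentiability at the origin of
    the exponential map, which is known at first only along lines. *)
Record admissible (f : 'rV[R]_n -> G) : Prop := Admissible {
  adm0 : f 0 = 1%g;
  adm_cvg : f @ (0 : 'rV[R]_n) --> 1%g;
  adm_diff : differentiable (fun X => crd c (f X)) 0 }.

Lemma adm_near f : admissible f -> \forall X \near (0 : 'rV[R]_n), dom c (f X).
Proof. by move=> [_ fc _]; apply: fc; exact: chart_dom_nbhs. Qed.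

Lemma adm_mul f h : admissible f -> admissible h ->
  admissible (fun X => f X * h X)%g.
Proof.
move=> fA hA; have [f0 fc fd] := fA; have [h0 hc hd] := hA; split.
- by rewrite f0 h0 mulg1.
- rewrite -[X in _ --> X](mulg1 1%g).
  by apply: (@lie_mul_cvg _ _ (nbhs_filter (0 : 'rV[R]_n)) f h).
pose p X := (crd c (f X), crd c (h X)).
have dp : differentiable p 0 by exact: differentiable_pair.
have dM : differentiable M (p 0).
  by rewrite /p; apply: chart_mul_diff; rewrite ?f0 ?h0// mulg1.
have En : \forall X \near (0 : 'rV[R]_n), M (p X) = crd c (f X * h X)%g.
  apply: filterS2 (adm_near fA) (adm_near hA) => X fX hX.
  by rewrite /chart_mul /p /= !chartK.
by have [] := near_diff_comp dp dM En.
Qed.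

Lemma adm_ops (l : 'rV[R]_n -> R) W : l 0 = 0 -> differentiable l 0 ->
  admissible (fun X => exp (l X *: W)).
Proof.
move=> l0 dl; have [E0 ec ed] := exp_vel W; split.
- by rewrite l0.
- have lc : l @ (0 : 'rV[R]_n) --> (0 : R).
    by rewrite -[X in _ --> X]l0; exact: differentiable_continuous.
  exact: cvg_comp lc ec.
- have [dF _] := ed; have dF' := proj1 (derivable1_diffP _ _) dF.
  apply: (@differentiable_comp _ _ _ _ l (fun t => crd c (exp (t *: W)))) => //.
  by rewrite l0.
Qed.

Lemma adm_one : admissible (fun=> 1%g).
Proof.
by split => //; exact: (@cst_continuous 'rV[R]_n G 1%g 0).
Qed.

Lemma coord_diff i : differentiable (fun X : 'rV[R]_n => X ord0 i) 0.
Proof. exact: differentiable_coord. Qed.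

Lemma coord0 i : (0 : 'rV[R]_n) ord0 i = 0.
Proof. by rewrite mxE. Qed.

Lemma adm_vertical (r : seq 'I_n) (l : 'I_n -> 'rV[R]_n -> R) (W : 'I_n -> 'rV[R]_n) :
  (forall i, l i 0 = 0) -> (forall i, differentiable (l i) 0) ->
  (forall i, W i \in V 2%N) ->
  admissible (fun X => exp (\sum_(i <- r) l i X *: W i)).
Proof.
move=> l0 dl W2; elim: r => [|i r IH].
  rewrite (_ : (fun X => _) = (fun=> 1%g)); first exact: adm_one.
  by apply/funext => X; rewrite big_nil exp0.
rewrite (_ : (fun X => _) = (fun X => exp (l i X *: W i) *
    exp (\sum_(j <- r) l j X *: W j))%g).
  by apply: adm_mul IH; exact: adm_ops.
apply/funext => X; rewrite big_cons exp_addV2//.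
by elim/big_ind : _ => [|u v|j _]; [exact: mem0v|exact: memvD|exact: memvZ].
Qed.

(** The product formula writes exp as a finite product of one-parameter subgroups
    whose parameters are polynomials in the coordinates. *)
Lemma exp_admissible : admissible exp.
Proof.
pose S (r : seq 'I_n) (X : 'rV[R]_n) := \sum_(i <- r) X ord0 i *: (delta_mx ord0 i : 'rV[R]_n).
suff H r : admissible (fun X => exp (S r X)).
  have := H (index_enum _); congr admissible; apply/funext => X.
  by rewrite /S -row_sum_delta.
elim: r => [|i r IH].
  rewrite (_ : (fun X => _) = (fun=> 1%g)); first exact: adm_one.
  by apply/funext => X; rewrite /S big_nil exp0.
pose ei := delta_mx ord0 i : 'rV[R]_n.
pose W j := br ei (delta_mx ord0 j).
rewrite (_ : (fun X => _) = (fun X : 'rV[R]_n => exp (X ord0 i *: ei) * exp (S r X) *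
    exp (\sum_(j <- r) (- 2^-1 * (X ord0 i * X ord0 j)) *: W j))%g).
  apply: adm_mul; first apply: adm_mul IH.
    by apply: (@adm_ops (fun X : 'rV[R]_n => X ord0 i)); [exact: coord0|exact: coord_diff].
  apply: (@adm_vertical r (fun j (X : 'rV[R]_n) => - 2^-1 * (X ord0 i * X ord0 j)) W).
  - by move=> j; rewrite !mxE mul0r mulr0.
  - move=> j; apply: (@differentiableZ _ _ _ (fun X : 'rV[R]_n => X ord0 i * X ord0 j)).
    apply: (@differentiableM _ _ (fun X : 'rV[R]_n => X ord0 i) (fun X : 'rV[R]_n => X ord0 j));
      exact: coord_diff.
  - by move=> j; exact: brk_in2.
apply/funext => X; rewrite {1}/S big_cons -/(S r X) -/ei.
have E : br (X ord0 i *: ei) (S r X) = X ord0 i *: \sum_(j <- r) X ord0 j *: W j.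
  rewrite (brkZl _ ei) (br_sumr brk_step2); congr (_ *: _); apply: eq_bigr => j _.
  exact: brkZr.
have E2 : 2^-1 *: br (X ord0 i *: ei) (S r X) +
    \sum_(j <- r) (- 2^-1 * (X ord0 i * X ord0 j)) *: W j = 0.
  rewrite E scalerA scaler_sumr -big_split /= big1// => j _.
  by rewrite scalerA -scalerDl (_ : _ + _ = 0) ?scale0r//; ring.
have W2 : \sum_(j <- r) (- 2^-1 * (X ord0 i * X ord0 j)) *: W j \in V 2%N.
  elim/big_ind : _ => [|u v|j _]; [exact: mem0v|exact: memvD|].
  by apply: memvZ; exact: brk_in2.
by rewrite expM -(exp_addV2 _ W2) -(addrA (_ + _)) E2 addr0.
Qed.

(** * Bijectivity of the exponential map *)

Lemma dilation_exp (delta : R -> G -> G) (l : R) Z1 Z2 : is_dilation exp 2 V delta ->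
  Z1 \in V 1%N -> Z2 \in V 2%N ->
  delta l (exp (Z1 + Z2)) = exp (l *: Z1 + l ^+ 2 *: Z2).
Proof.
move=> hdelta Z1V Z2V; have := hdelta l (fun i => if i == ord0 then Z1 else Z2).
rewrite !big_ord_recl !big_ord0 /= !addr0 expr1 => -> // i.
by case: (unliftP ord0 i) => [j|] -> //=; rewrite ord1.
Qed.

(** Two vectors with the same exponential keep this property under all dilations.
    The curve exp(l X1 + l^2 X2) has velocity X1 at 0, which recovers the
    horizontal part; the vertical part is then recovered from the one-parameter
    subgroup of X2. *)
Lemma exp_inj_of_dilation (delta : R -> G -> G) : is_dilation exp 2 V delta ->
  injective exp.
Proof.
move=> hdelta X Y XY.
have [X1 [X2 [X1V X2V EX]]] := strat_decomp X.
have [Y1 [Y2 [Y1V Y2V EY]]] := strat_decomp Y.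
have dilXY l : (exp (l *: X1) * exp (l ^+ 2 *: X2) = exp (l *: Y1) * exp (l ^+ 2 *: Y2))%g.
  rewrite -!exp_addV2 ?memvZ// -(dilation_exp l hdelta X1V X2V).
  by rewrite -(dilation_exp l hdelta Y1V Y2V) -EX -EY XY.
have dsq : is_derive (0 : R) 1 (fun t : R => t ^+ 2) 0.
  have := is_derive_poly ('X^2 : {poly R}) (0 : R).
  rewrite derivXn hornerMn hornerXn expr1 mul0rn.
  by rewrite (_ : horner 'X^2 = fun t : R => t ^+ 2)//; apply/funext => t; rewrite hornerXn.
have vdil Z1 Z2 : velocity (fun l : R => exp (l *: Z1) * exp (l ^+ 2 *: Z2))%g Z1.
  rewrite -[X in velocity _ X]addr0 -(scale0r Z2); apply: vel_mul (exp_vel Z1) _.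
  apply: (@vel_scale (fun t : R => exp (t *: Z2)) Z2 (fun t : R => t ^+ 2) 0 (exp_vel Z2)) => //.
  by rewrite expr0n.
have E1 : X1 = Y1.
  apply: vel_inj (vdil X1 X2) _.
  by rewrite (_ : (fun l : R => _) = (fun l : R => exp (l *: Y1) * exp (l ^+ 2 *: Y2))%g);
    [exact: vdil|exact/funext].
have pos (s : R) : 0 <= s -> exp (s *: X2) = exp (s *: Y2).
  by move=> s0; have := dilXY (Num.sqrt s); rewrite E1 => /mulgI; rewrite sqr_sqrtr.
rewrite EX EY E1; congr (_ + _); apply: exp_eq_germ => t.
have [t0|t0] := leP 0 t; first exact: pos.
by apply: invg_inj; rewrite -!expN -!scaleNr; apply: pos; rewrite oppr_ge0 ltW.
Qed.

(** The map X -> exp(- X) * par(e0 + X) has differential -X + X = 0 at the origin,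
    so near it the chart distance to the identity is at least halved. *)
Lemma newton_contraction : exists2 d, 0 < d & forall X : 'rV[R]_n, `|X| < d ->
  [/\ cod c (e0 + X), dom c (exp (- X) * par c (e0 + X))%g &
    `|crd c (exp (- X) * par c (e0 + X))%g - e0| <= 2^-1 * `|X|].
Proof.
have [E0 Ec dE] := exp_admissible.
have dN : differentiable (fun X : 'rV[R]_n => - X) 0 by apply: differentiableN.
have dEN : differentiable (fun X => crd c (exp (- X))) 0.
  apply: (@differentiable_comp _ _ _ _ (fun X => - X) (fun X => crd c (exp X))) => //.
  by rewrite oppr0.
have dT : differentiable (fun X : 'rV[R]_n => e0 + X) 0.
  by apply: differentiableD => //; exact: differentiable_cst.
pose p X := (crd c (exp (- X)), e0 + X).
have dp : differentiable p 0 by exact: differentiable_pair.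
have p0 : p 0 = (e0, e0) by rewrite /p oppr0 E0 addr0.
have dM : differentiable M (p 0).
  by rewrite p0; apply: chart_mul_diff => //; rewrite mulg1.
have ENc : (fun X => exp (- X)) @ (0 : 'rV[R]_n) --> 1%g.
  apply: (@cvg_comp _ _ _ (fun X : 'rV[R]_n => - X) exp _ (nbhs (0 : 'rV[R]_n))) => //.
  by rewrite -{2}oppr0; apply: differentiable_continuous dN.
have Tc : (fun X => e0 + X) @ (0 : 'rV[R]_n) --> e0.
  by rewrite -[X in _ --> X]addr0; exact: differentiable_continuous dT.
have N1 : \forall X \near (0 : 'rV[R]_n), dom c (exp (- X)).
  by apply: ENc; exact: chart_dom_nbhs.
have N2 : \forall X \near (0 : 'rV[R]_n), cod c (e0 + X).
  by apply: Tc; exact: chart_cod_nbhs.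
have N3 : \forall X \near (0 : 'rV[R]_n), dom c (exp (- X) * par c (e0 + X))%g.
  have pc : (fun X => par c (e0 + X)) @ (0 : 'rV[R]_n) --> 1%g.
    exact: cvg_comp Tc par_c_cvg.
  have mc : (fun X => exp (- X) * par c (e0 + X))%g @ (0 : 'rV[R]_n) --> (1 * 1)%g.
    exact: (@lie_mul_cvg _ _ (nbhs_filter (0 : 'rV[R]_n)) (fun X => exp (- X))
      (fun X => par c (e0 + X))).
  by apply: mc; apply: chart_dom_nbhs; rewrite ?mulg1.
have En : \forall X \near (0 : 'rV[R]_n), M (p X) = crd c (exp (- X) * par c (e0 + X))%g.
  by apply: filterS N1 => X cX; rewrite /chart_mul /p /= chartK.
have [dK EK] := near_diff_comp dp dM En.
have K0 X : 'd (fun X => crd c (exp (- X) * par c (e0 + X))%g) 0 X = 0.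
  have pX : velocity (fun t : R => par c (e0 + t *: X)) X.
    have dl : is_derive (0 : R) 1 (fun t : R => e0 + t *: X) X.
      rewrite -[X in is_derive _ _ _ X]add0r.
      exact: is_deriveD (is_derive_cst e0 (0 : R) 1) (is_derive_line X (0 : R)).
    have lc : (fun t : R => e0 + t *: X) @ (0 : R) --> e0.
      by have := is_derive_cvg dl; rewrite scale0r addr0.
    split.
    - by rewrite scale0r addr0 chartK.
    - exact: cvg_comp lc par_c_cvg.
    - apply: near_eq_is_derive dl.
      have : \forall t \near (0 : R), cod c (e0 + t *: X).
        by apply: lc; exact: chart_cod_nbhs.
      by apply: filterS => t ct; rewrite chart_parK.
  have vX := vel_mul (exp_vel (- X)) pX; rewrite addNr in vX.
  apply: is_derive_inj (is_derive_along_line X dK) _.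
  rewrite (_ : (fun t : R => _) = (fun t : R =>
    crd c (exp (t *: - X) * par c (e0 + t *: X))%g)); first exact: (vel_der vX).
  by apply/funext => t; rewrite scalerN.
have half0 : 0 < 2^-1 :> R by [].
have N4 := diff_bound dK half0.
have N5 : \forall X \near (0 : 'rV[R]_n), [/\ cod c (e0 + X),
    dom c (exp (- X) * par c (e0 + X))%g &
    `|crd c (exp (- X) * par c (e0 + X))%g - e0| <= 2^-1 * `|X|].
  apply: filterS3 N3 N2 N4 => X h3 h2; rewrite addr0 oppr0 E0 addr0 (chartK Ac c1) mulg1.
  by rewrite K0 subr0.
have [d d0 Hd] := proj1 (nbhs_ballP _ _) N5.
by exists d => // X Xd; apply: Hd; rewrite -ball_normE /= sub0r normrN.
Qed.

Lemma exp_continuous : continuous exp.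
Proof.
move=> Z; have [K K0 HK] := br_bound brk_step2.
(* the solution of [exp Y = exp Z * exp (W Y)], which vanishes at [Z] *)
pose W Y := Y - Z - 2^-1 *: br Z (Y - Z).
have EW Y : exp Y = (exp Z * exp (W Y))%g.
  have E : br Z (W Y) = br Z (Y - Z).
    rewrite /W (brBr brk_step2 Z (Y - Z)) (brkZr _ Z (br Z (Y - Z))) brk_nil.
    by rewrite scaler0 subr0.
  rewrite expM E /W; congr exp; move: (br Z (Y - Z)) => b.
  by apply/rowP => i; rewrite !mxE; ring.
have Wc : continuous W.
  apply: uniform_continuous => e e1; pose C := 1 + 2^-1 * (K * `|Z|).
  have C0 : 0 < C by rewrite ltr_pwDl// mulr_ge0// mulr_ge0// ltW.
  exists (C^-1 * e) => [|Y Y' YY]; first by rewrite mulr_gt0// invr_gt0.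
  have -> : W Y - W Y' = (Y - Y') - 2^-1 *: br Z (Y - Y').
    rewrite /W (brBr brk_step2 Z Y Z) (brBr brk_step2 Z Y' Z) (brBr brk_step2 Z Y Y').
    move: (br Z Y) (br Z Y') (br Z Z) => u v w.
    by apply/rowP => i; rewrite !mxE; ring.
  apply: (le_trans (ler_normB _ _)); rewrite normrZ ger0_norm ?invr_ge0//.
  have := HK Z (Y - Y'); have : C * `|Y - Y'| <= e by rewrite -ler_pdivlMl.
  by rewrite /C; lra.
have W0 : W Z = 0 by rewrite /W subrr (br0r brk_step2) scaler0 subrr.
have [_ Ec _] := exp_admissible.
have Wc0 : W @ Z --> (0 : 'rV[R]_n) by rewrite -W0; exact: Wc.
have h : (fun Y => exp Z * exp (W Y))%g @ Z --> (exp Z * 1)%g.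
  apply: (@lie_mul_cvg _ _ (nbhs_filter Z) (fun=> exp Z) (exp \o W)).
    exact: cst_continuous.
  exact: cvg_comp Wc0 Ec.
by move: h; rewrite mulg1 (_ : (fun Y => _) = exp)//; apply/funext => Y.
Qed.

(** Newton's method: multiplying g repeatedly by exp(- X), where X is the chart
    coordinate of the current remainder, gives remainders that tend to the
    identity, while the product of the factors removed so far is exp(Z) with Z in a
    bounded set.  Any accumulation point of these Z is a logarithm of g. *)
Lemma exp_near1 : \forall g \near (1%g : G), exists X, g = exp X.
Proof.
have [d d0 Hd] := newton_contraction.
have [K K0 HK] := br_bound brk_step2.
pose C := 1 + 2^-1 * K.
have C0 : 0 < C by rewrite addr_gt0// mulr_gt0.
pose r := Num.min (d / 2) ((2 * C)^-1).
have r0 : 0 < r by rewrite lt_min divr_gt0// invr_gt0 mulr_gt0.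
have rd : r < d.
  have : r <= d / 2 by rewrite ge_min lexx.
  by move: d0 => /=; lra.
have rC : C * r <= 2^-1.
  have : r <= (2 * C)^-1 by rewrite ge_min lexx orbT.
  rewrite -(ler_pM2l C0) (_ : C * (2 * C)^-1 = 2^-1)//.
  by field; rewrite gt_eqF.
have near_r : \forall g \near (1%g : G), `|crd c g - e0| < r.
  have := chart_crd_cts Ac c1 => /cvgrPdist_lt/(_ r r0).
  by apply: filterS => g; rewrite distrC.
apply: filterS2 near_r (chart_dom_nbhs Ac c1) => g gr cg.
(* Newton iteration: the first component records the logarithm of the product
   of the steps, the second one is the remainder *)
pose step (p : 'rV[R]_n * G) := (p.1 + (crd c p.2 - e0) + 2^-1 *: br p.1 (crd c p.2 - e0),
  exp (- (crd c p.2 - e0)) * p.2)%g.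
pose s k := iter k step (0, g).
have inv k : [/\ dom c (s k).2, `|crd c (s k).2 - e0| <= r * 2^-1 ^+ k,
    `|(s k).1| <= 1 - 2^-1 ^+ k & (exp (s k).1 * (s k).2)%g = g].
  elim: k => [|k [cs sr zs E]].
    by split; rewrite /= ?expr0 ?mulr1 ?subrr ?normr0 ?exp0 ?mul1g// ltW.
  move: cs sr zs E; rewrite /s iterS -/(s k); move: (s k) => [Z h] /= ch hr Zr E.
  have pk : 0 < 2^-1 ^+ k :> R by rewrite exprn_gt0.
  have pk1 : 2^-1 ^+ k <= 1 :> R by rewrite exprn_ile1// invf_le1// ler1n.
  set X := crd c h - e0 in hr *.
  have Xd : `|X| < d.
    by apply: le_lt_trans rd; apply: (le_trans hr); rewrite ler_piMr// ltW.
  have [_ h1 h2] := Hd X Xd.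
  have Eh : par c (e0 + X) = h by rewrite /X subrKC chartK.
  rewrite Eh in h1 h2.
  split => //.
  - apply: (le_trans h2); rewrite exprS mulrCA ler_pM2l//.
  - have bZ : `|2^-1 *: br Z X| <= 2^-1 * K * `|X|.
      rewrite normrZ ger0_norm ?invr_ge0// -mulrA ler_pM2l//.
      apply: (le_trans (HK _ _)); rewrite -mulrA ler_pM2l// ler_piMl//.
      by apply: (le_trans Zr); lra.
    have n1 := ler_normD (Z + X) (2^-1 *: br Z X).
    have n2 := ler_normD Z X.
    have h3 : C * `|X| <= 2^-1 * 2^-1 ^+ k.
      apply: (@le_trans _ _ (C * (r * 2^-1 ^+ k))); first by rewrite ler_pM2l.
      by rewrite mulrA ler_pM2r.
    rewrite exprS; move: h3 n1 n2 bZ Zr; rewrite /C; lra.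
  - by rewrite -expM -E mulgA -[(_ * exp (- X))%g]mulgA expN mulgV mulg1.
have Zle k : `|(s k).1| <= 1.
  have [_ _ h _] := inv k; apply: (le_trans h).
  by rewrite gerBl exprn_ge0.
have [Z HZ] := bounded_seq_cluster Zle.
exists Z; apply: esym; apply: lie_hausdorff => U W expZU gW.
(* [g] is the limit of [exp (s k).1], as the remainders [(s k).2] tend to 1 *)
have s2_cvg : (fun k => (s k).2) @ \oo --> 1%g.
  have cc : (fun k => crd c (s k).2) @ \oo --> e0.
    apply/cvgrPdist_le => e e1.
    have half1 : `|2^-1 : R| < 1 by rewrite ger0_norm// invf_lt1// ltr1n.
    have /cvgrPdist_le/(_ (e / r) (divr_gt0 e1 r0)) := cvg_expr half1.
    apply: filterS => k; rewrite sub0r normrN ger0_norm ?exprn_ge0// => hk.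
    have [_ h _ _] := inv k; rewrite distrC; apply: (le_trans h).
    by rewrite -ler_pdivlMl// mulrC.
  have : (fun k => par c (crd c (s k).2)) @ \oo --> 1%g by exact: cvg_comp cc par_c_cvg.
  rewrite (_ : (fun k => _) = (fun k => (s k).2))//.
  by apply/funext => k; have [ck _ _ _] := inv k; rewrite chartK.
have s1_cvg : (fun k => exp (s k).1) @ \oo --> g.
  have : (fun k => g * ((s k).2)^-1)%g @ \oo --> (g * 1^-1)%g.
    apply: (@lie_mul_cvg _ _ _ (fun=> g) (fun k => ((s k).2)^-1)%g); first exact: cvg_cst.
    exact: (@lie_inv_cvg _ _ _ (fun k => (s k).2)).
  rewrite invg1 mulg1 (_ : (fun k => _) = (fun k => exp (s k).1))//.
  by apply/funext => k; have [_ _ _ <-] := inv k; rewrite mulgK.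
have [j _ Hj] := s1_cvg _ gW.
have /nbhs_ballP[e /= e1 He] := exp_continuous expZU.
have [i ji hi] := HZ e j e1.
exists (exp (s i).1); split; last exact: Hj.
by apply: He; rewrite -ball_normE /= distrC.
Qed.

(** The image of exp is a subgroup and a neighbourhood of the identity, so it is
    open and closed. *)
Lemma exp_surj (hconn : connected [set: G]) g : exists X, g = exp X.
Proof.
pose H : set G := [set g | exists X, g = exp X].
suff HT : H = setT by have : setT g by []; rewrite -HT.
have HM a b : H a -> H b -> H (a * b)%g.
  by move=> [X ->] [Y ->]; eexists; exact: expM.
have HV a : H a -> H (a^-1)%g by move=> [X ->]; exists (- X); rewrite expN.
have trans_near a : \forall b \near a, H (a^-1 * b)%g.
  have tc : (fun b => a^-1 * b)%g @ a --> (a^-1 * a)%g.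
    by apply: (@lie_mul_cvg _ _ _ (fun=> a^-1)%g id); [exact: cvg_cst|exact: cvg_id].
  by apply: tc; rewrite mulVg; exact: exp_near1.
have Hopen : open H.
  rewrite openE => a Ha; apply: filterS (trans_near a) => b Hb.
  by rewrite -(mulVKg a b); exact: HM.
have Hclosed : closed H.
  rewrite -[H]setCK; apply: open_closedC; rewrite openE => a Ha.
  apply: filterS (trans_near a) => b Hab Hb; apply: Ha.
  have := HM _ _ Hb (HV _ Hab); rewrite invgM invgK mulgA mulgV mul1g.
  by [].
apply: hconn; first by exists 1%g, 0; rewrite exp0.
- by exists H => //; rewrite setTI.
- by exists H => //; rewrite setTI.
Qed.

(** * Geodesics in the group *)

Lemma strat_direct X Y : X \in V 1%N -> Y \in V 2%N -> X + Y = 0 -> X = 0 /\ Y = 0.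
Proof.
have [_ + _ _ _] := hV => /directv_sum_independent indep X1 Y2 XY.
have := indep (fun i : 'I_2 => if i == ord0 then X else Y).
rewrite !big_ord_recl big_ord0 /= addr0 => /(_ _ XY) h.
have {}h : forall i : 'I_2, true -> (if i == ord0 then X else Y) = 0.
  by apply: h => i _; case: (unliftP ord0 i) => [j|] -> //=; rewrite ord1.
by split; [exact: (h ord0 isT)|exact: (h (lift ord0 ord0) isT)].
Qed.

(** In the coordinates given by bases of the two layers, the distance to the
    identity is a homogeneous norm for the bracket of horizontal vectors, and
    [norm_geodesic_line] applies. *)
Lemma geodesic_affine (delta : R -> G -> G) (d : G -> G -> R) :
  connected [set: G] -> is_dilation exp 2 V delta -> homogeneous_distance delta d ->
  strictly_convex (V 1%N) (projection_norm exp d) ->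
  forall gamma : R -> G, infinite_geodesic d gamma -> affine exp gamma.
Proof.
move=> hconn hdelta [[d_ge0 d_eq0 d_sym d_tri] d_left d_dil] hconv gamma hgamma.
have exp_inj := exp_inj_of_dilation hdelta.
pose i1 := @basis_comb R n (V 1%N); pose i2 := @basis_comb R n (V 2%N).
have i1V u : i1 u \in V 1%N by exact: basis_comb_in.
have i2V w : i2 w \in V 2%N by exact: basis_comb_in.
have [B HB] : {B : 'rV[R]_(\dim (V 1%N)) * 'rV[R]_(\dim (V 1%N)) -> 'rV[R]_(\dim (V 2%N)) &
    forall p, br (i1 p.1) (i1 p.2) = i2 (B p)}.
  apply: (@choice _ _ (fun p w => br (i1 p.1) (i1 p.2) = i2 w)) => p.
  exact: basis_combP (strat_brk11 (i1V _) (i1V _)).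
pose B' u w := B (u, w).
have HB' u w : i2 (B' u w) = br (i1 u) (i1 w) by rewrite /B' -HB.
have brX u w u' w' : br (i1 u + i2 w) (i1 u' + i2 w') = i2 (B' u u').
  by rewrite HB'; exact: (strat_brk_reduce (i1V u) (i2V w) (i1V u') (i2V w')).
have [xz Hxz] : {xz : R -> 'rV[R]_(\dim (V 1%N)) * 'rV[R]_(\dim (V 2%N)) &
    forall t, gamma t = exp (i1 (xz t).1 + i2 (xz t).2)}.
  apply: (@choice _ _ (fun t p => gamma t = exp (i1 p.1 + i2 p.2))) => t.
  have [X EX] := exp_surj hconn (gamma t).
  have [X1 [X2 [X1V X2V E]]] := strat_decomp X.
  have [u Eu] := basis_combP X1V; have [w Ew] := basis_combP X2V.
  by exists (u, w); rewrite EX E Eu Ew.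
pose x t := (xz t).1; pose z t := (xz t).2.
pose N u w := d 1%g (exp (i1 u + i2 w)).
have d1V g : d 1%g (g^-1)%g = d 1%g g.
  by rewrite -(d_left g) mulg1 mulgV d_sym.
have hN : step2_norm B' N.
  split.
  - split=> [u u' w|a u w|u w]; apply: (@basis_comb_inj R n (V 2%N)); rewrite -/i2.
    + rewrite [in RHS]/i2 basis_combD -/i2 !HB' /i1 basis_combD -/i1.
      exact: brkDl.
    + by rewrite [in RHS]/i2 basis_combZ -/i2 !HB' /i1 basis_combZ -/i1; exact: brkZl.
    + by rewrite [in RHS]/i2 basis_combN -/i2 !HB'; exact: brk_anti.
  - by rewrite /N /i1 /i2 !basis_comb0 addr0 exp0; apply/d_eq0.
  - move=> u w /d_eq0/esym; rewrite -exp0 => /exp_inj/(strat_direct (i1V u) (i2V w)).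
    by move=> [/basis_comb_eq0 -> /basis_comb_eq0 ->].
  - by move=> u w; rewrite /N /i1 /i2 !basis_combN -opprD expN d1V.
  - move=> u u' w w'; rewrite /N.
    have -> : exp (i1 (u + u') + i2 (w + w' + 2^-1 *: B' u u')) =
        (exp (i1 u + i2 w) * exp (i1 u' + i2 w'))%g.
      rewrite expM brX /i1 /i2 !basis_combD basis_combZ; congr exp.
      by rewrite addrA addrACA.
    apply: (le_trans (d_tri _ (exp (i1 u + i2 w)) _)).
    by have := d_left (exp (i1 u + i2 w)) 1%g (exp (i1 u' + i2 w')); rewrite mulg1 => ->.
  - move=> l u w l0; rewrite /N /i1 /i2 !basis_combZ -/i1 -/i2.
    rewrite -(dilation_exp l hdelta (i1V u) (i2V w)) -d_dil//; congr d.
    by rewrite -exp0 -{2}(addr0 0) (dilation_exp l hdelta (mem0v _) (mem0v _)) !scaler0 addr0.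
have hgeo : norm_geodesic B' N x z.
  move=> s t; rewrite -hgamma d_sym -(d_left (gamma s)^-1%g) mulVg /N; congr d.
  rewrite !Hxz -expN expM -/(x s) -/(z s) -/(x t) -/(z t).
  have -> : br (- (i1 (x s) + i2 (z s))) (i1 (x t) + i2 (z t)) = - i2 (B' (x s) (x t)).
    by rewrite (brNl brk_step2) brX.
  congr exp; rewrite /vdisp /i1 /i2 !(basis_combD, basis_combN, basis_combZ).
  by move: (basis_comb _) => *; apply/rowP => i; rewrite !mxE; ring.
have hconv' : ~ exists X Y : 'rV[R]_(\dim (V 1%N)), X <> Y /\
    forall t : R, 0 <= t <= 1 -> N ((1 - t) *: X + t *: Y) 0 = 1.
  move=> [X [Y [XY h]]]; apply: hconv; exists (i1 X), (i1 Y); split=> //.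
    by move=> /basis_comb_inj.
  move=> t /h; rewrite /N /projection_norm /i1 /i2 basis_comb0 addr0.
  by rewrite basis_combD !basis_combZ.
have [v Hv] := norm_geodesic_line hN hconv' hgeo.
exists (gamma 0), (i1 v) => t; have [Ex Ez] := Hv t.
rewrite !Hxz -/(x t) -/(z t) -/(x 0) -/(z 0) Ex Ez expM.
have := brX (x 0) (z 0) (t *: v) 0; rewrite [in LHS]/i2 basis_comb0 addr0 -/i2.
rewrite /i1 (basis_combZ t v) -/i1 => ->.
rewrite /i1 /i2 !basis_combD !basis_combZ; congr exp.
by rewrite addrA [X in X + _ = _]addrAC.
Qed.

End LieGroup.

Theorem corollary1p2 (R : realType) (n : nat) (G : topGroupType)
    (A : set (chart R n G)) (c : chart R n G) (V : nat -> {vspace 'rV[R]_n})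
    (exp : 'rV[R]_n -> G) (delta : R -> G -> G) (d : G -> G -> R)
    (hG : stratified_group A c 2 V)
    (hexp : is_exp c exp)
    (hdelta : is_dilation exp 2 V delta)
    (hd : homogeneous_distance delta d)
    (hconv : strictly_convex (V 1%N) (projection_norm exp d)) :
  forall gamma : R -> G, infinite_geodesic d gamma -> affine exp gamma.
Proof.
have [hL hconn _ [Ac c1] hV] := hG.
exact: (geodesic_affine hL Ac c1 hexp hV hconn hdelta hd hconv).
Qed.
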